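(* Assume (A1)–(A4) (stated in the context). Consider the primal problem $$d^{\rm reg}_{\delta,C}(f,g):=\inf_{k\in L^2_\delta(\Omega)}\left\{\int_\Omega C(x,y)k(x,y)\,dx\,dy+\tfrac12\|k\|_{L^2}^2+\tfrac12F(k_x\mid f)+\tfrac12F(k_y\mid g)\right\}\qquad(\mathrm P)$$ and the dual problem $$D^{\rm reg}_{\delta,C}(f,g):=\inf_{k_1^*\in L^2(\Omega_f),\;k_2^*\in L^2(\Omega_g)}\left\{\bar C^*_\delta(k_1^*+k_2^* )+\tfrac12F^*_{\delta|\Omega_g|}(-2k_1^*\mid f)+\tfrac12F^*_{\delta|\Omega_f|}(-2k_2^*\mid g)\right\},\qquad(\mathrm D)$$ where $(k_1^*+k_2^* )(x,y)=k_1^*(x)+k_2^*(y)$. Then both (P) and (D) admit minimizers. Furthermore, $k$ is a minimizer of (P) and $(k_1^*,k_2^* )$ is a minimizer of (D) if and only if $$k(x,y)=\max\{\delta,\;k_1^*(x)+k_2^*(y)-C(x,y)\},$$ $$k_x(x)=f(x)\max\left\{\frac{\delta|\Omega_g|}{f(x)},\;1-k_1^*(x)\right\},\qquad k_y(y)=g(y)\max\left\{\frac{\delta|\Omega_f|}{g(y)},\;1-k_2^*(y)\right\}$$ for Lebesgue-almost every $x\in\Omega_f$ and $y\in\Omega_g$. Additionally, $$d^{\rm reg}_{\delta,C}(f,g)+D^{\rm reg}_{\delta,C}(f,g)=0.$$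
   Context: Let $d\in\mathbb N$ and let $\mathcal L$ be Lebesgue measure. For $c>0$, $\mathcal M^\infty_{\mathcal L,c}$ is the set of measures $\mu=f\mathcal L$ on $\mathbb R^d$ such that $f\in L^\infty(\mathbb R^d)$, $f$ has compact support, and $f\ge c$ a.e. on its support. Write $\Omega_f=\operatorname{supp} f$, $\Omega_g=\operatorname{supp} g$, $\Omega=\Omega_f\times\Omega_g$, and $|\cdot|$ for Lebesgue measure of a set. $C:\mathbb R^d\times\mathbb R^d\to[0,\infty)$ is a cost function and $\delta>0$. Assumptions: (A1) $f\mathcal L,g\mathcal L\in\mathcal M^\infty_{\mathcal L,c}$; (A2) $\Omega_f,\Omega_g$ are convex with $C^{1,1}$ boundary; (A3) $\delta\max\{|\Omega_f|,|\Omega_g|\}\le c$; (A4) $C$ is locally Hölder continuous. For a set $A$ and $\theta>0$, $L^2_\theta(A)=\{u\in L^2(A): u\ge\theta\text{ a.e. on }A\}$. For $k\in L^2(\Omega)$ the marginal densities are $k_x(x)=\int_{\Omega_g}k(x,y)\,dy$ and $k_y(y)=\int_{\Omega_f}k(x,y)\,dx$. For $v\mathcal L\in\mathcal M^\infty_{\mathcal L,c}$ and $u\in L^2(\operatorname{supp}v)$, $F(u\mid v)=\int_{\operatorname{supp}v}\left(\frac uv-1\right)^2v\,dx$ (Pearson divergence). For $\theta>0$ and $u^*\in L^2(\operatorname{supp}v)$, $$F^*_\theta(u^*\mid v)=\sup_{u\in L^2_\theta(\operatorname{supp}v)}\left\{\int_{\operatorname{supp}v}uu^*\,dx-F(u\mid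 v)\right\},$$ and for $w^*\in L^2(\Omega)$, $$\bar C^*_\delta(w^* )=\sup_{k\in L^2_\delta(\Omega)}\left\{\int_\Omega kw^*\,dx\,dy-\int_\Omega Ck\,dx\,dy-\tfrac12\|k\|_{L^2}^2\right\}.$$ *)

(* Defs.v *)
(* MathComp-Analysis, over an arbitrary [R : realType]. *)
From HB Require Import structures.
From mathcomp Require Import all_boot all_order all_algebra.
From mathcomp Require Import all_classical all_reals all_analysis.
Set Implicit Arguments.
Unset Strict Implicit.
Unset Printing Implicit Defensive.
Import Order.TTheory GRing.Theory Num.Theory.
Import numFieldNormedType.Exports.
Local Open Scope classical_set_scope.
Local Open Scope ring_scope.

(* The library has no measurable structure on row vectors: as it does for
   tuples, we take the sigma-algebra generated by the coordinates, i.e. the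
   product of the Borel sigma-algebras. *)
Definition measure_rV_display : measure_display.
Proof. exact: default_measure_display. Qed.

Section measurable_rV.
Context {R : realType} (n : nat).

Definition rV_coord (i : 'I_n) (x : 'rV[R]_n) : measurableTypeR R := x ord0 i.

Let rV_set0 : g_sigma_preimage rV_coord set0.
Proof. exact: sigma_algebra0. Qed.

Let rV_setC A :
  g_sigma_preimage rV_coord A -> g_sigma_preimage rV_coord (~` A).
Proof. exact: sigma_algebraC. Qed.

Let rV_bigcup (F : _^nat) : (forall i, g_sigma_preimage rV_coord (F i)) ->
  g_sigma_preimage rV_coord (\bigcup_i (F i)).
Proof. exact: sigma_algebra_bigcup. Qed.

HB.instance Definition _ := @isMeasurable.Build measure_rV_display
  'rV[R]_n (g_sigma_preimage rV_coord) rV_set0 rV_setC rV_bigcup.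

Lemma measurable_rV_coord (i : 'I_n) : measurable_fun [set: 'rV[R]_n] (rV_coord i).
Proof.
move=> _ Y mY; rewrite setTI; apply: sub_sigma_algebra => /=.
rewrite -bigcup_seq/=; exists i => /=; first by rewrite mem_index_enum.
by exists Y => //; rewrite setTI.
Qed.

Lemma measurable_fun_rVP d (T : measurableType d) (f : T -> 'rV[R]_n) :
  (forall i, measurable_fun [set: T] (rV_coord i \o f)) ->
  measurable_fun [set: T] f.
Proof.
move=> mf.
suff prefS : g_sigma_preimage (fun i => rV_coord i \o f) `<=` measurable.
  rewrite g_sigma_preimage_comp in prefS.
  by move=> _ A mA; apply: prefS; exists A.
apply: smallest_sub; first exact: sigma_algebra_measurable.
move=> A; rewrite -bigcup_seq => -[i _ [B mB <-]].
exact: mf.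
Qed.

End measurable_rV.

Section lebesgue_rV.
Context {R : realType}.

Definition rV_cons n (p : measurableTypeR R * 'rV[R]_n) : 'rV[R]_n.+1 :=
  \row_(i < n.+1) oapp (fun j => p.2 ord0 j) p.1 (unlift ord0 i).

Definition rV_uncons n (x : 'rV[R]_n.+1) : measurableTypeR R * 'rV[R]_n :=
  (x ord0 ord0, \row_(i < n) x ord0 (lift ord0 i)).

Lemma rV_consK n : cancel (@rV_cons n) (@rV_uncons n).
Proof.
move=> [a x]; rewrite /rV_uncons /rV_cons !mxE unlift_none/=; congr pair.
by apply/rowP => i; rewrite !mxE liftK.
Qed.

Lemma rV_unconsK n : cancel (@rV_uncons n) (@rV_cons n).
Proof.
move=> x; apply/rowP => i; rewrite mxE /=.
by case: unliftP => [j ->|->] //=; rewrite mxE.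
Qed.

Lemma measurable_rV_cons n : measurable_fun setT (@rV_cons n).
Proof.
apply: measurable_fun_rVP => i.
have [j ->|->] := unliftP ord0 i.
  rewrite (_ : _ \o _ = rV_coord j \o snd); last first.
    by apply/funext => p; rewrite /= /rV_coord /rV_cons mxE liftK.
  by apply: measurableT_comp => //; exact: measurable_rV_coord.
rewrite (_ : _ \o _ = fst) //.
by apply/funext => p; rewrite /= /rV_coord /rV_cons mxE unlift_none.
Qed.

Lemma measurable_rV_uncons n : measurable_fun setT (@rV_uncons n).
Proof.
apply/measurable_fun_pairP; split.
  exact: measurable_rV_coord.
apply: measurable_fun_rVP => i.
rewrite (_ : _ \o _ = rV_coord (lift ord0 i)); first exact: measurable_rV_coord.
by apply/funext => x; rewrite /= /rV_coord mxE.
Qed.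

Section step.
Local Open Scope ereal_scope.
Context n (m : {sigma_finite_measure set 'rV[R]_n -> \bar R}).

Definition rV_cons_measure : set 'rV[R]_n.+1 -> \bar R :=
  pushforward (@lebesgue_measure R \x m) (@rV_cons n).

Let preim_cons A : measurable A -> measurable (@rV_cons n @^-1` A).
Proof. by move=> mA; rewrite -[X in measurable X]setTI; exact: measurable_rV_cons. Qed.

Let rV_cons_measure0 : rV_cons_measure set0 = 0.
Proof. by rewrite /rV_cons_measure /pushforward preimage_set0 measure0. Qed.

Let rV_cons_measure_ge0 A : 0 <= rV_cons_measure A.
Proof. by rewrite /rV_cons_measure /pushforward measure_ge0. Qed.

Let rV_cons_measure_sigma_additive : semi_sigma_additive rV_cons_measure.
Proof.
move=> F mF tF mUF; rewrite /rV_cons_measure /pushforward preimage_bigcup.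
apply: measure_semi_sigma_additive.
- by move=> k; exact: preim_cons.
- apply/trivIsetP => /= i j _ _ ij; rewrite -preimage_setI.
  by move/trivIsetP : tF => /(_ _ _ _ _ ij) ->//; rewrite preimage_set0.
- by rewrite -preimage_bigcup; exact: preim_cons.
Qed.

HB.instance Definition _ := isMeasure.Build _ _ _ rV_cons_measure
  rV_cons_measure0 rV_cons_measure_ge0 rV_cons_measure_sigma_additive.

Let rV_cons_measure_sigma_finite : sigma_finite setT rV_cons_measure.
Proof.
have [F TF Foo] : sigma_finite setT (@lebesgue_measure R \x m).
  have /sigma_finiteP[F [TF ndF Foo]] := sigma_finiteT (@lebesgue_measure R).
  have /sigma_finiteP[G [TG ndG Goo]] := sigma_finiteT m.
  exists (fun k => F k `*` G k).
    rewrite -setXTT TF TG predeqE => -[x y]; split.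
      move=> [/= [i _ Fix] [j _ Gjy]]; exists (maxn i j) => //; split.
      - by move: x Fix; exact/subsetPset/ndF/leq_maxl.
      - by move: y Gjy; exact/subsetPset/ndG/leq_maxr.
    by move=> [i _ []/= ? ?]; split; exists i.
  move=> k; have [? ?] := Foo k; have [? ?] := Goo k.
  split; first exact: measurableX.
  by rewrite product_measure1E// lte_mul_pinfty// ge0_fin_numE.
exists (fun k => @rV_uncons n @^-1` F k).
  by rewrite -preimage_bigcup -TF preimage_setT.
move=> k; have [mFk Fkoo] := Foo k; split.
  by rewrite -[X in measurable X]setTI; exact: measurable_rV_uncons.
rewrite /rV_cons_measure /pushforward -comp_preimage.
rewrite (_ : _ @^-1` _ = F k)//.
by apply/seteqP; split => p /=; rewrite rV_consK.
Qed.

HB.instance Definition _ := Measure_isSigmaFinite.Build _ _ _ rV_cons_measure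
  rV_cons_measure_sigma_finite.

End step.

Section dirac_rV0.
Let dirac_rV0_sigma_finite :
  sigma_finite setT (@dirac _ 'rV[R]_0 (0 : 'rV[R]_0) R).
Proof.
exists (fun=> setT); first by rewrite bigcup_const//; exists 0%N.
by move=> _; split => //; rewrite diracT ltry.
Qed.

HB.instance Definition _ := Measure_isSigmaFinite.Build _ _ _
  (@dirac _ 'rV[R]_0 (0 : 'rV[R]_0) R) dirac_rV0_sigma_finite.
End dirac_rV0.

(* Lebesgue measure on R^n, as an iterated product of the one-dimensional one;
   see [lebesgue_rV_box] for its values on boxes. *)
Fixpoint lebesgue_rV n : {sigma_finite_measure set 'rV[R]_n -> \bar R} :=
  match n with
  | 0 => @dirac _ 'rV[R]_0 0 R
  | n'.+1 => rV_cons_measure (lebesgue_rV n')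
  end.

Definition rV_box n (a b : 'rV[R]_n) : set 'rV[R]_n :=
  [set x | forall i, x ord0 i \in `]a ord0 i, b ord0 i] ].

Lemma measurable_rV_box n (a b : 'rV[R]_n) : measurable (rV_box a b).
Proof.
rewrite (_ : rV_box a b = \bigcap_(i in [set: 'I_n])
    (@rV_coord R n i @^-1` [set` `]a ord0 i, b ord0 i] ])); last first.
  by apply/seteqP; split => x /= h i; [move=> _; exact: h|exact: h].
apply: fin_bigcap_measurable => //.
move=> i _; rewrite -[X in measurable X]setTI; apply: measurable_rV_coord => //.
Qed.

Lemma lebesgue_rV_box n (a b : 'rV[R]_n) :
  (forall i, a ord0 i <= b ord0 i) ->
  lebesgue_rV n (rV_box a b) = (\prod_(i < n) (b ord0 i - a ord0 i))%:E.
Proof.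
elim: n => [|n IHn] in a b * => ab.
  by rewrite /= big_ord0 diracE mem_set// => -[].
rewrite big_ord_recl EFinM /= /rV_cons_measure /pushforward.
pose a' : 'rV[R]_n := \row_i a ord0 (lift ord0 i).
pose b' : 'rV[R]_n := \row_i b ord0 (lift ord0 i).
rewrite (_ : _ @^-1` _ = [set` `]a ord0 ord0, b ord0 ord0] ] `*` rV_box a' b').
  rewrite product_measure1E//=; last exact: measurable_rV_box.
  have ab0 := ab ord0; rewrite lebesgue_measure_itv /= lte_fin IHn; last first.
    by move=> i; rewrite !mxE.
  congr (_ * _)%E; last by congr EFin; apply: eq_bigr => i _; rewrite !mxE.
  case: ltP => // ba; have -> : b ord0 ord0 = a ord0 ord0 by apply/le_anti/andP.
  by rewrite subrr.
apply/seteqP; split => -[t x] /= => [h|[h0 h] i].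
  split; first by have := h ord0; rewrite mxE unlift_none.
  by move=> i; have := h (lift ord0 i); rewrite !mxE liftK.
by case: (unliftP ord0 i) => [j ->|->]; rewrite mxE ?liftK ?unlift_none//=;
  have := h j; rewrite !mxE.
Qed.

End lebesgue_rV.

Section L2.
Context d (T : measurableType d) (R : realType).
Variable mu : {measure set T -> \bar R}.
Local Open Scope ereal_scope.

(* Elements of L^2(A) are represented by functions on the whole space, whose
   values outside of A are irrelevant. *)
Definition L2 (A : set T) : set (T -> R) :=
  [set u | restrict A u \in Lfun mu 2%:E].

Definition L2_ge (theta : R) (A : set T) : set (T -> R) :=
  [set u | L2 A u /\ \forall x \ae mu, A x -> (theta <= u x)%R].

Definition sqr_L2norm (A : set T) (u : T -> R) : \bar R :=
  'N[mu]_(2%:E)[EFin \o restrict A u] ^+ 2.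

End L2.

Definition is_minimizer (R : realType) (X : Type) (A : set X) (J : X -> \bar R)
    (x : X) : Prop :=
  A x /\ forall y, A y -> (J x <= J y)%E.

Section regularity.
Context {R : realType}.

Definition locally_hoelder (V : normedModType R) (C : V -> R) : Prop :=
  forall p : V, exists (alpha L : R) (U : set V),
    [/\ 0 < alpha, alpha <= 1, nbhs p U &
      forall q r, U q -> U r -> `|C q - C r| <= L * `|q - r| `^ alpha].

Definition C11 n (gamma : 'rV[R]_n -> R) : Prop :=
  (forall x, differentiable gamma x) /\
  exists L : R, forall x y v,
    `|'d gamma x v - 'd gamma y v| <= L * `|x - y| * `|v|.

(* Near each of its boundary points A is, after permuting and reorienting the
   coordinate axes, the (closed) epigraph of a C^{1,1} function of the other
   n - 1 coordinates; [col' i x] is x with its i-th coordinate removed. *)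
Definition C11_boundary n (A : set 'rV[R]_n) : Prop :=
  forall x0, (closure A `\` A°) x0 ->
    exists (i : 'I_n) (s : bool) (gamma : 'rV[R]_n.-1 -> R),
      C11 gamma /\
      \forall x \near x0, A x <-> gamma (col' i x) <= (-1) ^+ s * x ord0 i.

End regularity.

Section problem.
Context {R : realType} {n : nat}.
Local Notation Rn := 'rV[R]_n.
Local Notation leb := (@lebesgue_rV R n).
Local Notation leb2 := (leb \x leb)%E.
Implicit Types (f g u v : Rn -> R) (C k w : Rn * Rn -> R).
Local Open Scope ereal_scope.

(* As f is only defined up to a null set, its support is the complement of the
   largest open set on which it vanishes almost everywhere. *)
Definition supp f : set Rn :=
  ~` \bigcup_(U in [set U | open U /\ \forall x \ae leb, U x -> f x = 0%R]) U.

(* f is the density of a measure of the class M^oo_{L,c} *)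
Definition Moo (c : R) f : Prop :=
  [/\ f \in Lfun leb +oo, compact (supp f) &
      \forall x \ae leb, supp f x -> (c <= f x)%R].

Definition vol (A : set Rn) : R := fine (leb A).

Definition marginal_x (B : set Rn) k (x : Rn) : R :=
  (\int[leb]_(y in B) k (x, y))%R.

Definition marginal_y (A : set Rn) k (y : Rn) : R :=
  (\int[leb]_(x in A) k (x, y))%R.

Definition pearson u v : \bar R :=
  \int[leb]_(x in supp v) ((u x / v x - 1) ^+ 2 * v x)%:E.

Definition pearson_conj (theta : R) u' v : \bar R :=
  ereal_sup [set \int[leb]_(x in supp v) (u x * u' x)%:E - pearson u v
            | u in L2_ge leb theta (supp v)].

Definition cost_conj (delta : R) C (Omega : set (Rn * Rn)) w : \bar R :=
  ereal_sup [set \int[leb2]_(p in Omega) (k p * w p)%:E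
                 - \int[leb2]_(p in Omega) (C p * k p)%:E
                 - (2^-1)%R%:E * sqr_L2norm leb2 Omega k
            | k in L2_ge leb2 delta Omega].

Definition primal_dom (delta : R) f g : set (Rn * Rn -> R) :=
  L2_ge leb2 delta (supp f `*` supp g).

Definition primal_obj C f g k : \bar R :=
  \int[leb2]_(p in supp f `*` supp g) (C p * k p)%:E
  + (2^-1)%R%:E * sqr_L2norm leb2 (supp f `*` supp g) k
  + (2^-1)%R%:E * pearson (marginal_x (supp g) k) f
  + (2^-1)%R%:E * pearson (marginal_y (supp f) k) g.

Definition primal_value (delta : R) C f g : \bar R :=
  ereal_inf [set primal_obj C f g k | k in primal_dom delta f g].

Definition dual_dom f g : set ((Rn -> R) * (Rn -> R)) :=
  L2 leb (supp f) `*` L2 leb (supp g).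

Definition dual_obj (delta : R) C f g (h : (Rn -> R) * (Rn -> R)) : \bar R :=
  cost_conj delta C (supp f `*` supp g) (fun p => h.1 p.1 + h.2 p.2)%R
  + (2^-1)%R%:E * pearson_conj (delta * vol (supp g)) (fun x => - 2 * h.1 x)%R f
  + (2^-1)%R%:E * pearson_conj (delta * vol (supp f)) (fun y => - 2 * h.2 y)%R g.

Definition dual_value (delta : R) C f g : \bar R :=
  ereal_inf [set dual_obj delta C f g h | h in dual_dom f g].

End problem.

(* Main.v *)
Require Import Defs.
From HB Require Import structures.
From mathcomp Require Import all_boot all_order all_algebra.
From mathcomp Require Import all_classical all_reals all_analysis.
From mathcomp Require Import ess_sup_inf measurable_realfun ring lra.
Set Implicit Arguments.
Unset Strict Implicit.
Unset Printing Implicit Defensive.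
Import Order.TTheory GRing.Theory Num.Theory.
Import numFieldNormedType.Exports.
Local Open Scope classical_set_scope.
Local Open Scope ring_scope.

(** The two problems are tied by a pointwise computation. Every conjugate in the
    dual objective is the supremum, over functions bounded below by some
    [theta], of the integral of a concave quadratic [b t - t^2 / v - e] of the value
    [t]; such a supremum is attained at the pointwise maximizer
    [max theta (v b / 2)], and a competitor loses at least the integral of its squared
    distance to the maximizer divided by [v] ([quad_argmax_gap], [ereal_sup_quad]).
    For the cost this maximizer is [max delta (h1 + h2 - C)]; for the Pearson
    divergences it is [f * max (theta / f) (1 - h1)] and its analogue for [g].

    Fubini's theorem turns the pairing of [k] with [h1 + h2] into pairings of its
    marginals with [h1] and [h2], so these terms cancel in the sum of the primal
    and dual objectives: the sum is exactly the total loss of [k] and of its two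
    marginals with respect to the three maximizers ([duality_gapE]). Hence it is
    nonnegative, and it is zero if and only if [k] and its marginals are equal
    almost everywhere to the maximizers, which are the three equations of the
    theorem. As soon as one pair with zero sum exists, it consists of minimizers,
    the infima add up to zero, and the pairs of minimizers are exactly those with
    zero sum ([minimizers_of_zero_gap]).

    Such a pair is found by solving
      f (1 - h1) = \int max delta (h1 + h2 - C) dy,
      g (1 - h2) = \int max delta (h1 + h2 - C) dx
    in bounded measurable functions. Moving [h1] against the residual of the first
    equation divided by [f + |supp g|], and [h2] likewise, contracts the sup norm
    because [f] and [g] are bounded below by [c > 0] ([damped_step_contraction]), so a
    fixed point exists ([dual_system_solution]). The plan [max delta (h1 + h2 - C)] then
    has marginals [f (1 - h1)] and [g (1 - h2)], and the pair has zero sum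
    ([zero_gap_pair]).

    The densities satisfy their bounds only almost everywhere on their supports,
    and the cost is bounded only on the compact product of the supports; they are
    replaced by functions satisfying the bounds everywhere, which changes none of
    the integrals. *)

(** * Square-integrable functions on a set *)

Section square_integrable.
Context d (T : measurableType d) (R : realType).
Variables (mu : {measure set T -> \bar R}) (A : set T).
Hypothesis mA : measurable A.
Implicit Types (u v w b : T -> R).

Lemma integral_EFin_Rintegral u : mu.-integrable A (EFin \o u) ->
  (\int[mu]_(x in A) (u x)%:E)%E = (\int[mu]_(x in A) u x)%:E.
Proof. by move=> iu; rewrite /Rintegral fineK// integrable_fin_num. Qed.

(** Membership in [L2] speaks of the extension by zero to the whole space;
    this restates it with integrals over [A] only. *)
Lemma L2P u : L2 mu A u <->
  measurable_fun A u /\ mu.-integrable A (EFin \o (fun x => u x ^+ 2)).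
Proof.
have sqE : (EFin \o (fun x => u x ^+ 2)) \_ A =
    EFin \o (fun x => (u \_ A) x ^+ 2).
  by apply/funext => x; rewrite /patch/=; case: ifPn; rewrite ?expr0n.
split => [Lu|[mu' iu]].
  split; last by apply/integrable_mkcond => //; rewrite sqE; exact: Lfun2_integrable_sqr.
  apply/(measurable_restrictT u mA).
  by move: Lu; rewrite /L2/= inE => /andP[]; rewrite inE.
rewrite /L2/= inE; apply/andP; split.
  by rewrite inE/=; exact/(measurable_restrictT u mA).
rewrite inE/= /finite_norm unlock poweR_lty//.
move: iu => /(integrable_mkcond _ mA); rewrite sqE => /integrableP[_].
apply: le_lt_trans; rewrite le_eqVlt; apply/orP; left; apply/eqP.
apply: eq_integral => x _ /=.
by rewrite powR_mulrn// normrX.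
Qed.

Lemma sqr_L2normE u : L2 mu A u ->
  sqr_L2norm mu A u = (\int[mu]_(x in A) u x ^+ 2)%:E.
Proof.
move=> /[dup] Lu /L2P[_ iu]; rewrite /sqr_L2norm.
have fN : ('N[mu]_(2%:E)[EFin \o u \_ A])%E \is a fin_num.
  move: Lu; rewrite /L2/= inE => /andP[_]; rewrite inE/= /finite_norm => ltN.
  by rewrite ge0_fin_numE// Lnorm_ge0.
have : (('N[mu]_(2%:E)[EFin \o u \_ A]) `^ 2 =
   'N[mu]_(2%:E)[EFin \o u \_ A] ^+ 2)%E.
  rewrite -(fineK fN) poweR_EFin powR_mulrn ?fine_ge0 ?Lnorm_ge0//.
move=> <-; rewrite poweR_Lnorm// -integral_EFin_Rintegral//.
rewrite [RHS]integral_mkcond; apply: eq_integral => x _ /=.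
rewrite powR_mulrn// -normrX ger0_norm ?sqr_ge0//.
by rewrite /patch; case: ifPn; rewrite ?expr0n.
Qed.

Lemma L2_mul_integrable u v : L2 mu A u -> L2 mu A v ->
  mu.-integrable A (EFin \o (fun x => u x * v x)).
Proof.
move=> /L2P[mu' iu] /L2P[mv iv].
apply: (@le_integrable _ _ _ mu _ mA _
  ((EFin \o (fun x => u x ^+ 2)%R) \+ (EFin \o (fun x => v x ^+ 2)%R))%E).
- by apply/measurable_EFinP; exact: measurable_funM.
- move=> x Ax /=; rewrite lee_fin [leRHS]ger0_norm ?addr_ge0 ?sqr_ge0//.
  rewrite ler_norml; apply/andP; split; nra.
- exact: integrableD.
Qed.

Lemma L2_le v u : measurable_fun A u -> (forall x, A x -> `|u x| <= `|v x|) ->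
  L2 mu A v -> L2 mu A u.
Proof.
move=> mu' uv /L2P[mv iv]; apply/L2P; split => //.
apply: (le_integrable mA _ _ iv).
  by apply/measurable_EFinP; exact: measurable_funX.
by move=> x Ax /=; rewrite lee_fin !normrX lerXn2r ?nnegrE// uv.
Qed.

Lemma L2D u v : L2 mu A u -> L2 mu A v -> L2 mu A (fun x => u x + v x).
Proof.
move=> Lu Lv; have iuv := L2_mul_integrable Lu Lv.
move: Lu Lv => /L2P[mu' iu] /L2P[mv iv]; apply/L2P; split.
  exact: measurable_funD.
rewrite (_ : _ \o _ = ((EFin \o (fun x => u x ^+ 2)%R) \+
  ((EFin \o (fun x => v x ^+ 2)%R) \+
   (fun x => 2%:E * (EFin \o (fun x => u x * v x)%R) x)))%E); last first.
  apply/funext => x /=; congr (_%:E); rewrite sqrrD -mulr_natl; ring.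
by apply: integrableD => //; apply: integrableD => //; exact: integrableZl.
Qed.

(** The multiplier only has to be bounded on [A], the products being compared
    there with [M * u]. *)
Lemma L2M_bounded (M : R) b u : measurable_fun A b ->
  (forall x, A x -> `|b x| <= M) -> L2 mu A u -> L2 mu A (fun x => b x * u x).
Proof.
move=> mb bM /[dup] Lu /L2P[mu' iu].
have LMu : L2 mu A (fun x => M * u x).
  apply/L2P; split; first exact: measurable_funM.
  rewrite (_ : _ \o _ = (fun x => (M ^+ 2)%R%:E * (EFin \o (fun x => u x ^+ 2)%R) x)%E).
    exact: integrableZl.
  by apply/funext => x /=; rewrite exprMn.
apply: L2_le LMu; first exact: measurable_funM.
move=> x Ax; rewrite !normrM ler_wpM2r//.
by rewrite (le_trans (bM x Ax))// ler_norm.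
Qed.

Lemma L2Z (a : R) u : L2 mu A u -> L2 mu A (fun x => a * u x).
Proof. by move=> Lu; apply: (@L2M_bounded `|a|). Qed.

Lemma L2B u v : L2 mu A u -> L2 mu A v -> L2 mu A (fun x => u x - v x).
Proof.
move=> Lu /(L2Z (-1)) Lv; have := L2D Lu Lv.
by under eq_fun do rewrite mulN1r.
Qed.

Hypothesis fA : (mu A < +oo)%E.

Lemma integrable_cst_lty (r : R) : mu.-integrable A (EFin \o cst r).
Proof.
exact: (measurable_bounded_integrable mA fA (measurable_cst _) (bounded_cst r A)).
Qed.

Lemma L2_bounded (M : R) u : measurable_fun A u ->
  (forall x, A x -> `|u x| <= M) -> L2 mu A u.
Proof.
move=> mu' uM; apply: (@L2_le (cst M)) => //.
  by move=> x Ax; rewrite (le_trans (uM x Ax))// ler_norm.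
apply/L2P; split => //.
exact: integrable_cst_lty (M ^+ 2).
Qed.

Lemma L2_integrable u : L2 mu A u -> mu.-integrable A (EFin \o u).
Proof.
move=> Lu.
have L1 : L2 mu A (cst 1).
  by apply: (@L2_bounded 1) => // x _; rewrite normr1.
have := L2_mul_integrable Lu L1.
by apply: eq_integrable => // x _ /=; rewrite mulr1.
Qed.

Lemma L2_max (theta : R) u : L2 mu A u -> L2 mu A (fun x => Num.max theta (u x)).
Proof.
move=> Lu.
have Lt : L2 mu A (cst `|theta|).
  by apply: (@L2_bounded `|theta|) => // x _; rewrite normr_id.
have Lu' : L2 mu A (fun x => `|u x|).
  move: (Lu) => /L2P[mu' _]; apply: L2_le Lu; first exact: measurableT_comp.
  by move=> x _; rewrite normr_id.
apply: L2_le (L2D Lt Lu').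
  by move: Lu => /L2P[mu' _]; apply: measurable_maxr.
move=> x _ /=; rewrite (ger0_norm (addr_ge0 _ _))//.
rewrite /Num.max; case: ifPn => _; first by rewrite lerDr.
by rewrite lerDl.
Qed.

Lemma Rintegral_eq0_ae u : mu.-integrable A (EFin \o u) ->
  (forall x, A x -> 0 <= u x) -> \int[mu]_(x in A) u x = 0 ->
  \forall x \ae mu, A x -> u x = 0.
Proof.
move=> iu u0 I0.
have : (\int[mu]_(x in A) `|(EFin \o u) x| = 0)%E.
  under eq_integral => x /set_mem Ax do rewrite /= ger0_norm ?u0//.
  by rewrite integral_EFin_Rintegral// I0.
move/(ae_eq_integral_abs mu mA (measurable_int _ iu)).
by apply: filterS => x /= h Ax; have := h Ax => -[].
Qed.

End square_integrable.

(** * Pointwise maximization of concave quadratic integrands *)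

Section measurable_inverse_and_ae_equality.
Context d (T : measurableType d) (R : realType).

(** The real power is measurable and agrees with the inverse on positive
    numbers; writing [t^-1] as [t * (t ^+ 2)^-1] brings the other signs and the
    value [0^-1 = 0] back to that case. *)
Lemma measurable_fun_inv (A : set T) (v : T -> R) :
  measurable_fun A v -> measurable_fun A (fun x => (v x)^-1).
Proof.
move=> mv; rewrite (_ : (fun x => _) = fun x => v x * (v x ^+ 2) `^ (-1)).
  apply: measurable_funM => //.
  by apply: (measurableT_comp (measurable_powR _)); exact: measurable_funX.
apply/funext => x; rewrite powR_inv1 ?sqr_ge0//.
have [->|v0] := eqVneq (v x) 0; first by rewrite invr0 mul0r.
by rewrite expr2 invfM mulrA divff// mul1r.
Qed.

Lemma Rintegral_ae_eq (mu : {measure set T -> \bar R}) (A : set T) (u w : T -> R) :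
  measurable A -> measurable_fun A u -> measurable_fun A w ->
  (\forall x \ae mu, A x -> u x = w x) ->
  \int[mu]_(x in A) u x = \int[mu]_(x in A) w x.
Proof.
move=> mA mu' mw uw; congr fine; apply: ae_eq_integral => //.
- exact/measurable_EFinP.
- exact/measurable_EFinP.
- by apply: filterS uw => x uw Ax; rewrite uw.
Qed.

End measurable_inverse_and_ae_equality.

Section quadratic_maximization.
Context d (T : measurableType d) (R : realType).
Variables (mu : {measure set T -> \bar R}) (A : set T).
Hypotheses (mA : measurable A) (fA : (mu A < +oo)%E).
Variables (theta v0 v1 e1 : R) (v b e : T -> R).
Hypotheses (v0_gt0 : 0 < v0) (mv : measurable_fun A v)
  (v_ge : forall x, A x -> v0 <= v x) (v_le : forall x, A x -> v x <= v1)
  (Lb : L2 mu A b) (me : measurable_fun A e)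
  (e_le : forall x, A x -> `|e x| <= e1).
Implicit Types u : T -> R.

(** The integrands of both Fenchel conjugates have this form: for the cost,
    [v = 2], [b = w - C] and [e = 0]; for the Pearson divergence from the density
    [v], [b = u' + 2] and [e = v]. *)
Definition quad (x : T) (t : R) := b x * t - t ^+ 2 / v x - e x.

(** The vertex of the parabola, moved to [theta] when it lies to its left. *)
Definition quad_argmax (x : T) := Num.max theta (v x * b x / 2).

Let v_gt0 x : A x -> 0 < v x.
Proof. by move=> Ax; exact: lt_le_trans (v_ge Ax). Qed.

(** Strong concavity: at a constrained maximizer [m] with vertex [s], the
    first-order term [(t - m) * (m - s)] is nonnegative for all admissible [t], and
    what remains of the loss is the square. It makes maximizers unique. *)
Lemma quad_argmax_gap x t : A x -> theta <= t ->
  (t - quad_argmax x) ^+ 2 / v x <= quad x (quad_argmax x) - quad x t.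
Proof.
move=> Ax tt; have vx := v_gt0 Ax; rewrite /quad /quad_argmax.
set s := v x * b x / 2.
have -> : b x = 2 * (v x)^-1 * s by rewrite /s; field; rewrite gt_eqF.
set m := Num.max theta s.
have mst : 0 <= (t - m) * (m - s).
  rewrite /m; have [ts|st] := leP theta s; first by rewrite subrr mulr0.
  by rewrite mulr_ge0 ?subr_ge0// ltW.
rewrite -subr_ge0.
rewrite (_ : _ - _ = 2 * (v x)^-1 * ((t - m) * (m - s))); last by ring.
by rewrite mulr_ge0// mulr_ge0// invr_ge0 ltW.
Qed.

Lemma L2_quad_argmax : L2 mu A quad_argmax.
Proof.
apply: L2_max => //; under eq_fun do rewrite mulrC; apply: L2Z => //.
apply: (L2M_bounded mA (M := v1)) => // x Ax.
by rewrite ger0_norm ?v_le// ltW// v_gt0.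
Qed.

Lemma L2_ge_quad_argmax : L2_ge mu theta A quad_argmax.
Proof.
split; first exact: L2_quad_argmax.
by apply: aeW => x _; rewrite le_max lexx.
Qed.

Lemma integrable_sqr_div u : L2 mu A u ->
  mu.-integrable A (EFin \o (fun x => u x ^+ 2 / v x)).
Proof.
move=> Lu; have Lvu : L2 mu A (fun x => (v x)^-1 * u x).
  apply: (L2M_bounded mA (M := v0^-1)) => //.
    exact: measurable_fun_inv.
  move=> x Ax; rewrite ger0_norm ?invr_ge0 ?(ltW (v_gt0 Ax))//.
  by rewrite lef_pV2 ?posrE ?v_gt0// v_ge.
apply: eq_integrable (L2_mul_integrable mA Lu Lvu) => // x _ /=.
by congr (_%:E); ring.
Qed.

Lemma integrable_quad u : L2 mu A u ->
  mu.-integrable A (EFin \o (fun x => quad x (u x))).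
Proof.
move=> Lu.
have := integrableB mA (integrableB mA (L2_mul_integrable mA Lb Lu)
  (integrable_sqr_div Lu)) (L2_integrable mA fA (L2_bounded mA fA me e_le)).
by apply: eq_integrable.
Qed.

Definition quad_int u := \int[mu]_(x in A) quad x (u x).

Lemma quad_int_ae_eq u w : L2 mu A u -> L2 mu A w ->
  (\forall x \ae mu, A x -> u x = w x) -> quad_int u = quad_int w.
Proof.
move=> Lu Lw uw; apply: Rintegral_ae_eq => //.
- exact/measurable_EFinP/(measurable_int mu)/integrable_quad.
- exact/measurable_EFinP/(measurable_int mu)/integrable_quad.
- by apply: filterS uw => x uw Ax; rewrite uw.
Qed.

(** Replacing an admissible competitor by its pointwise maximum with [theta]
    only changes it on a null set, and makes the constraint hold everywhere. *)
Let truncate u : L2_ge mu theta A u ->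
  let w := fun x => Num.max theta (u x) in
  [/\ L2 mu A w, \forall x \ae mu, A x -> u x = w x & quad_int u = quad_int w].
Proof.
move=> [Lu ut] /=; have Lw := L2_max mA fA theta Lu.
have uw : \forall x \ae mu, A x -> u x = Num.max theta (u x).
  by apply: filterS ut => x ut Ax; rewrite max_r// ut.
by split => //; exact: quad_int_ae_eq.
Qed.

Lemma quad_int_le u : L2_ge mu theta A u -> quad_int u <= quad_int quad_argmax.
Proof.
move=> /truncate[Lw uw ->]; apply: le_Rintegral => //.
- exact: integrable_quad.
- exact/integrable_quad/L2_quad_argmax.
- move=> x Ax; rewrite -subr_ge0; apply: le_trans (quad_argmax_gap Ax _).
    by rewrite mulr_ge0 ?sqr_ge0// invr_ge0 ltW// v_gt0.
  by rewrite le_max lexx.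
Qed.

(** When the integrals agree the nonnegative loss vanishes almost everywhere,
    and by [quad_argmax_gap] it dominates the squared distance to the maximizer. *)
Lemma quad_int_max_ae u : L2_ge mu theta A u ->
  quad_int u = quad_int quad_argmax <->
  \forall x \ae mu, A x -> u x = quad_argmax x.
Proof.
move=> /[dup] -[Lu _] /truncate[Lw uw quw]; split; last first.
  by move=> um; apply: quad_int_ae_eq => //; exact: L2_quad_argmax.
rewrite quw => qw.
have im := integrable_quad L2_quad_argmax.
have iw := integrable_quad Lw.
have gap x : A x -> (Num.max theta (u x) - quad_argmax x) ^+ 2 / v x <=
    quad x (quad_argmax x) - quad x (Num.max theta (u x)).
  by move=> Ax; apply: quad_argmax_gap => //; rewrite le_max lexx.
have sq0 x : A x -> 0 <= (Num.max theta (u x) - quad_argmax x) ^+ 2 / v x.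
  by move=> Ax; rewrite mulr_ge0 ?sqr_ge0// invr_ge0 ltW// v_gt0.
have : \forall x \ae mu, A x ->
    quad x (quad_argmax x) - quad x (Num.max theta (u x)) = 0.
  apply: Rintegral_eq0_ae => //.
  - have := integrableB mA im iw; exact: eq_integrable.
  - by move=> x Ax; exact: le_trans (sq0 x Ax) (gap x Ax).
  - by rewrite RintegralB//; apply/eqP; rewrite subr_eq0; apply/eqP; exact: esym qw.
apply: filterS2 uw => x uw g0 Ax; have := gap x Ax.
rewrite g0// => le0.
have : (Num.max theta (u x) - quad_argmax x) ^+ 2 / v x = 0.
  by apply/eqP; rewrite eq_le le0 sq0.
move=> /eqP; rewrite mulf_eq0 invr_eq0 (gt_eqF (v_gt0 Ax)) orbF sqrf_eq0 subr_eq0.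
by rewrite -uw// => /eqP.
Qed.

(** Supremum and integral can be exchanged because the pointwise maximizer is
    itself square-integrable and admissible. *)
Lemma ereal_sup_quad :
  ereal_sup [set (quad_int u)%:E | u in L2_ge mu theta A] =
  (quad_int quad_argmax)%:E.
Proof.
apply/eqP; rewrite eq_le; apply/andP; split.
  by apply: ge_ereal_sup => _ [u uA <-]; rewrite lee_fin quad_int_le.
by apply: ereal_sup_ubound; exists quad_argmax => //; exact: L2_ge_quad_argmax.
Qed.

End quadratic_maximization.

(** * Fubini's theorem on rectangles *)

Section fubini_rectangle.
Context d1 d2 (T1 : measurableType d1) (T2 : measurableType d2) (R : realType).
Variables (m1 : {sigma_finite_measure set T1 -> \bar R})
  (m2 : {sigma_finite_measure set T2 -> \bar R}) (A : set T1) (B : set T2).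
Hypotheses (mA : measurable A) (mB : measurable B).
Local Notation m12 := (m1 \x m2)%E.

Let mAB : measurable (A `*` B). Proof. exact: measurableX. Qed.

Let patchE (F : T1 * T2 -> \bar R) x y : (F \_ (A `*` B)) (x, y) =
  if (x \in A) && (y \in B) then F (x, y) else 0%E.
Proof.
rewrite /patch; congr (if _ then _ else _).
by apply/idP/andP; rewrite !inE.
Qed.

Let patchx (F : T1 * T2 -> \bar R) x : (fun y => (F \_ (A `*` B)) (x, y)) =
  if x \in A then (fun y => F (x, y)) \_ B else cst 0%E.
Proof. by apply/funext => y; rewrite patchE; case: (x \in A). Qed.

Let patchy (F : T1 * T2 -> \bar R) y : (fun x => (F \_ (A `*` B)) (x, y)) =
  if y \in B then (fun x => F (x, y)) \_ A else cst 0%E.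
Proof.
apply/funext => x; rewrite patchE andbC; by case: (y \in B).
Qed.

Let fine_integrable d (T : measurableType d) (m : {measure set T -> \bar R})
    (D : set T) (G : T -> \bar R) : measurable D -> m.-integrable D G ->
  m.-integrable D (EFin \o (fine \o G)) /\
  (\int[m]_(x in D) fine (G x) = fine (\int[m]_(x in D) G x)%E).
Proof.
move=> mD iG; have mG := measurable_int _ iG.
have mfG : measurable_fun D (EFin \o (fine \o G)).
  by apply/measurable_EFinP; exact: measurableT_comp.
split.
  apply: (le_integrable mD mfG _ iG) => x Dx /=.
  by case: (G x) => [r| |]//=; rewrite normr0 leey.
congr fine; apply: ae_eq_integral => //.
by apply: filterS (integrable_ae mD iG) => x Gx Dx; rewrite /= fineK// Gx.
Qed.

Let integrable_fubini_G (F : T1 * T2 -> \bar R) : m12.-integrable setT F ->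
  m2.-integrable setT (fubini_G m1 F).
Proof.
move=> iF; have mF := measurable_int _ iF.
have mabs : measurable_fun setT (abse \o F) by exact: measurableT_comp.
have mG : measurable_fun setT (fubini_G m1 (abse \o F)).
  by apply: measurable_fun_fubini_tonelli_G => // p; exact: abse_ge0.
apply: (@le_integrable _ _ _ m2 _ measurableT _ (fubini_G m1 (abse \o F))) => //.
- exact: (measurable_fubini_G iF).
- move=> y _; rewrite [leRHS]gee0_abs; last by apply: integral_ge0 => x _; exact: abse_ge0.
  by apply: le_abse_integral => //; exact: measurableT_comp.
- apply/integrableP; split => //.
  under eq_integral => y _.
    rewrite gee0_abs; last by apply: integral_ge0 => x _; exact: abse_ge0.
    over.
  exact: (integrable21ltyP _ _ mF).1 iF.
Qed.

(** The inner integrals may be infinite on a null set, where the real-valued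
    integral is [0]; this affects neither integrability nor the outer integral. *)
Lemma Fubini_rectangle_x (F : T1 * T2 -> R) :
  m12.-integrable (A `*` B) (EFin \o F) ->
  [/\ {ae m1, forall x, A x -> m2.-integrable B (EFin \o (fun y => F (x, y)))},
      m1.-integrable A (EFin \o (fun x => \int[m2]_(y in B) F (x, y))) &
      \int[m1]_(x in A) (\int[m2]_(y in B) F (x, y)) =
        \int[m12]_(p in A `*` B) F p].
Proof.
move=> /(integrable_mkcond _ mAB) iF.
have FE : fubini_F m2 ((EFin \o F) \_ (A `*` B)) =
    (fun x => \int[m2]_(y in B) (F (x, y))%:E)%E \_ A.
  apply/funext => x; rewrite /fubini_F patchx /patch.
  by case: ifPn => xA; rewrite -?integral_mkcond// integral0_eq.
have iG : m1.-integrable A (fun x => \int[m2]_(y in B) (F (x, y))%:E)%E.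
  by apply/(integrable_mkcond _ mA); rewrite -FE; exact: integrable_fubini_F.
have [ifG fGE] := fine_integrable mA iG; split => //.
- apply: filterS (ae_integrable1 iF) => x /= + Ax.
  by rewrite patchx mem_set//; move/(integrable_mkcond _ mB).
- rewrite [LHS]fGE /Rintegral; congr fine.
  by rewrite [RHS]integral_mkcond -(integral12_prod_meas1 iF) FE -integral_mkcond.
Qed.

Lemma Fubini_rectangle_y (F : T1 * T2 -> R) :
  m12.-integrable (A `*` B) (EFin \o F) ->
  [/\ {ae m2, forall y, B y -> m1.-integrable A (EFin \o (fun x => F (x, y)))},
      m2.-integrable B (EFin \o (fun y => \int[m1]_(x in A) F (x, y))) &
      \int[m2]_(y in B) (\int[m1]_(x in A) F (x, y)) =
        \int[m12]_(p in A `*` B) F p].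
Proof.
move=> /(integrable_mkcond _ mAB) iF.
have FE : fubini_G m1 ((EFin \o F) \_ (A `*` B)) =
    (fun y => \int[m1]_(x in A) (F (x, y))%:E)%E \_ B.
  apply/funext => y; rewrite /fubini_G patchy /patch.
  by case: ifPn => yB; rewrite -?integral_mkcond// integral0_eq.
have iG : m2.-integrable B (fun y => \int[m1]_(x in A) (F (x, y))%:E)%E.
  by apply/(integrable_mkcond _ mB); rewrite -FE; exact: integrable_fubini_G.
have [ifG fGE] := fine_integrable mB iG; split => //.
- apply: filterS (ae_integrable2 iF) => y /= + By.
  by rewrite patchy mem_set//; move/(integrable_mkcond _ mA).
- rewrite [LHS]fGE /Rintegral; congr fine.
  by rewrite [RHS]integral_mkcond -(integral21_prod_meas1 iF) FE -integral_mkcond.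
Qed.

Let measurable_fun_fst (u : T1 -> R) : measurable_fun A u ->
  measurable_fun (A `*` B) (fun p => u p.1).
Proof.
move=> mu; apply: (measurable_comp (F := A)) => //.
- by move=> _ [p [Ap _] <-].
- exact: measurable_funTS.
Qed.

Let measurable_fun_snd (u : T2 -> R) : measurable_fun B u ->
  measurable_fun (A `*` B) (fun p => u p.2).
Proof.
move=> mu; apply: (measurable_comp (F := B)) => //.
- by move=> _ [p [_ Bp] <-].
- exact: measurable_funTS.
Qed.

Hypotheses (fA : (m1 A < +oo)%E) (fB : (m2 B < +oo)%E).

Lemma L2_rectangle_fst (u : T1 -> R) : L2 m1 A u ->
  L2 m12 (A `*` B) (fun p => u p.1).
Proof.
move=> /(L2P _ mA)[mu iu]; apply/(L2P _ mAB); split; first exact: measurable_fun_fst.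
apply/(integrable_mkcond _ mAB).
set G := _ \_ _; have mG : measurable_fun setT G.
  apply/(measurable_restrictT _ mAB); apply/measurable_EFinP.
  by apply: measurable_funX; exact: measurable_fun_fst.
apply/(integrable12ltyP _ _ mG).
under eq_integral => x _.
  rewrite (_ : (fun y => `|G (x, y)|%E) =
      if x \in A then (fun y => (u x ^+ 2)%:E) \_ B else cst 0%E); last first.
    apply/funext => y; rewrite /G patchE/= /patch.
    case: (x \in A); case: (y \in B) => //=; rewrite ?normr0//.
    by rewrite ger0_norm ?sqr_ge0.
  over.
rewrite (_ : (fun x => _) =
    (fun x => m2 B * (EFin \o (fun x => u x ^+ 2)%R) x)%E \_ A); last first.
  apply/funext => x; rewrite /patch; case: ifPn => xA; last by rewrite integral0_eq.
  by rewrite -integral_mkcond integral_cst// muleC.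
rewrite -integral_mkcond -(fineK (x := m2 B)) ?ge0_fin_numE//.
rewrite integralZl// lte_mul_pinfty// ?lee_fin ?fine_ge0//.
by rewrite ltey_eq (integrable_fin_num mA iu).
Qed.

Lemma L2_rectangle_snd (u : T2 -> R) : L2 m2 B u ->
  L2 m12 (A `*` B) (fun p => u p.2).
Proof.
move=> /(L2P _ mB)[mu iu]; apply/(L2P _ mAB); split; first exact: measurable_fun_snd.
apply/(integrable_mkcond _ mAB).
set G := _ \_ _; have mG : measurable_fun setT G.
  apply/(measurable_restrictT _ mAB); apply/measurable_EFinP.
  by apply: measurable_funX; exact: measurable_fun_snd.
apply/(integrable21ltyP _ _ mG).
under eq_integral => y _.
  rewrite (_ : (fun x => `|G (x, y)|%E) =
      if y \in B then (fun x => (u y ^+ 2)%:E) \_ A else cst 0%E); last first.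
    apply/funext => x; rewrite /G patchE/= /patch.
    case: (y \in B); case: (x \in A) => //=; rewrite ?normr0//.
    by rewrite ger0_norm ?sqr_ge0.
  over.
rewrite (_ : (fun x => _) =
    (fun y => m1 A * (EFin \o (fun y => u y ^+ 2)%R) y)%E \_ B); last first.
  apply/funext => y; rewrite /patch; case: ifPn => yB; last by rewrite integral0_eq.
  by rewrite -integral_mkcond integral_cst// muleC.
rewrite -integral_mkcond -(fineK (x := m1 A)) ?ge0_fin_numE//.
rewrite integralZl// lte_mul_pinfty// ?lee_fin ?fine_ge0//.
by rewrite ltey_eq (integrable_fin_num mB iu).
Qed.


End fubini_rectangle.

(** * Marginals of square-integrable functions *)

Section marginals.
Context d d1 d2 (T : measurableType d) (T1 : measurableType d1)
  (T2 : measurableType d2) (R : realType).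
Variables (m : {measure set T -> \bar R}) (m1 : {measure set T1 -> \bar R})
  (m2 : {measure set T2 -> \bar R}).
Variables (Om : set T) (A : set T1) (B : set T2) (s : T1 -> T2 -> T).
Hypotheses (mOm : measurable Om) (mA : measurable A) (mB : measurable B).
Hypotheses (fOm : (m Om < +oo)%E) (fB : (m2 B < +oo)%E).
(* Both marginals of a rectangle are instances: [s] is the pairing, with its
   arguments exchanged for the second marginal. *)
Hypothesis fubini : forall F : T -> R, m.-integrable Om (EFin \o F) ->
  [/\ {ae m1, forall x, A x -> m2.-integrable B (EFin \o (fun y => F (s x y)))},
      m1.-integrable A (EFin \o (fun x => \int[m2]_(y in B) F (s x y))) &
      \int[m1]_(x in A) (\int[m2]_(y in B) F (s x y)) = \int[m]_(p in Om) F p].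
Implicit Types k : T -> R.

Definition slice_marginal k (x : T1) : R := \int[m2]_(y in B) k (s x y).

(** The marginal of [`|k - k'|] has integral zero, hence vanishes almost
    everywhere, and it dominates the difference of the marginals. This avoids
    slicing null sets of the product. *)
Lemma slice_marginal_ae_eq k k' : L2 m Om k -> L2 m Om k' ->
  (\forall p \ae m, Om p -> k p = k' p) ->
  \forall x \ae m1, A x -> slice_marginal k x = slice_marginal k' x.
Proof.
move=> Lk Lk' kk'.
have iB := L2_integrable mOm fOm (L2B mOm Lk Lk').
have iF : m.-integrable Om (EFin \o (fun p => `|k p - k' p|)).
  exact: integrable_norm iB.
have I0 : \int[m]_(p in Om) `|k p - k' p| = 0.
  rewrite (@Rintegral_ae_eq _ _ _ _ _ _ (cst 0))//.
  - by rewrite Rintegral_cst// mul0r.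
  - exact/measurable_EFinP/(measurable_int m).
  - by apply: filterS kk' => p kk' Op; rewrite kk'// subrr normr0.
have [sF mF eF] := fubini iF.
have [sk _ _] := fubini (L2_integrable mOm fOm Lk).
have [sk' _ _] := fubini (L2_integrable mOm fOm Lk').
have F0 : \forall x \ae m1, A x -> \int[m2]_(y in B) `|k (s x y) - k' (s x y)| = 0.
  apply: Rintegral_eq0_ae => //; last exact: etrans eF I0.
  by move=> x _; apply: Rintegral_ge0 => y _; exact: normr_ge0.
move: F0 sk sk'; apply: filterS3 => x /= Fx0 + + Ax => /(_ Ax) kx /(_ Ax) k'x.
apply/eqP; rewrite -subr_eq0 -normr_le0 -RintegralB//.
rewrite -(Fx0 Ax); apply: le_normr_Rintegral => //.
by have := integrableB mB kx k'x; exact: eq_integrable.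
Qed.

Lemma slice_marginal_ge (theta : R) k : L2_ge m theta Om k ->
  \forall x \ae m1, A x -> theta * fine (m2 B) <= slice_marginal k x.
Proof.
move=> [Lk tk].
have Lk' := L2_max mOm fOm theta Lk.
have kk' : \forall p \ae m, Om p -> k p = Num.max theta (k p).
  by apply: filterS tk => p tk Op; rewrite max_r// tk.
have [sk _ _] := fubini (L2_integrable mOm fOm Lk').
apply: filterS2 (slice_marginal_ae_eq Lk Lk' kk') sk => x /= e kx Ax.
rewrite e// -Rintegral_cst//; apply: le_Rintegral => //.
- exact: (integrable_cst_lty mB fB theta).
- exact: kx.
- by move=> y By; rewrite le_max lexx.
Qed.

(** Expand the integral of [(u - t) ^+ 2], which is nonnegative, at
    [t = (\int u) / (m2 B + 1)]. The [+ 1] spares the case of a null [B]. *)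
Lemma sqr_Rintegral_le (u : T2 -> R) : m2.-integrable B (EFin \o u) ->
  m2.-integrable B (EFin \o (fun y => u y ^+ 2)) ->
  (\int[m2]_(y in B) u y) ^+ 2 <=
    (fine (m2 B) + 1) * \int[m2]_(y in B) u y ^+ 2.
Proof.
move=> iu iu2; set beta := fine (m2 B); set I := Rintegral _ _ u.
have beta0 : 0 <= beta by exact: fine_ge0.
pose t := I / (beta + 1).
have ic : m2.-integrable B (EFin \o (fun=> t ^+ 2)).
  exact: (integrable_cst_lty mB fB).
have itu : m2.-integrable B (EFin \o (fun y => 2 * t * u y)).
  by have := integrableZl mB (2 * t) iu; exact: eq_integrable.
have : 0 <= \int[m2]_(y in B) (u y - t) ^+ 2.
  by apply: Rintegral_ge0 => y _; exact: sqr_ge0.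
rewrite (@eq_Rintegral _ _ _ _ _
  (fun y => u y ^+ 2 - 2 * t * u y + t ^+ 2)); last by move=> y _ /=; ring.
rewrite RintegralD//; last first.
  by have := integrableB mB iu2 itu; exact: eq_integrable.
rewrite RintegralB// RintegralZl// Rintegral_cst// -/beta -/I.
set J := Rintegral _ _ _ => J0.
have IE : I = (beta + 1) * t by rewrite /t mulrC divfK// gt_eqF// ltr_wpDl.
rewrite IE in J0 *; nra.
Qed.

Lemma L2_slice_marginal k : L2 m Om k -> L2 m1 A (slice_marginal k).
Proof.
move=> Lk; have ik := L2_integrable mOm fOm Lk.
have [_ ik2] := (L2P _ mOm _).1 Lk.
have [sk mk _] := fubini ik; have [sk2 mk2 _] := fubini ik2.
have msm : measurable_fun A (slice_marginal k).
  exact/measurable_EFinP/(measurable_int _ mk).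
have mm2 : measurable_fun A (EFin \o (fun x => slice_marginal k x ^+ 2)).
  by apply/measurable_EFinP; exact: measurable_funX.
apply/(L2P _ mA); split => //; apply/integrableP; split => //.
have iM : m1.-integrable A (fun x =>
    (fine (m2 B) + 1)%:E * (\int[m2]_(y in B) k (s x y) ^+ 2)%R%:E)%E.
  exact: integrableZl.
apply: (@le_lt_trans _ _ (\int[m1]_(x in A) (fun x =>
    (fine (m2 B) + 1)%:E * (\int[m2]_(y in B) k (s x y) ^+ 2)%R%:E) x)%E); last first.
  by rewrite ltey_eq (integrable_fin_num mA iM).
apply: ae_ge0_le_integral => //.
- exact: measurableT_comp.
- move=> x Ax; rewrite -EFinM lee_fin; apply: mulr_ge0.
    by rewrite addr_ge0// fine_ge0.
  by apply: Rintegral_ge0 => y _; exact: sqr_ge0.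
- exact: (measurable_int m1).
apply: filterS2 sk sk2 => x /= kx k2x Ax.
rewrite lee_fin ger0_norm ?sqr_ge0//.
exact: sqr_Rintegral_le (kx Ax) (k2x Ax).
Qed.

(** A factor depending on one variable only sees the marginal: this is what
    makes the cross terms of the primal and dual objectives cancel. *)
Lemma Rintegral_slice_marginalM k (pi : T -> T1) (h : T1 -> R) :
  (forall x y, pi (s x y) = x) -> measurable_fun A h -> L2 m Om k -> L2 m Om (h \o pi) ->
  \int[m]_(p in Om) (k p * h (pi p)) =
  \int[m1]_(x in A) (slice_marginal k x * h x).
Proof.
move=> pis mh Lk Lh; have ikh := L2_mul_integrable mOm Lk Lh.
have [sk _ _] := fubini (L2_integrable mOm fOm Lk).
have [skh mkh <-] := fubini ikh.
congr fine; apply: ae_eq_integral => //.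
- exact: (measurable_int m1).
- apply/measurable_EFinP; apply: measurable_funM => //.
  by move: (L2_slice_marginal Lk) => /(L2P _ mA)[].
apply: filterS sk => x /= kx Ax; congr (_%:E).
under eq_Rintegral do rewrite pis.
by rewrite RintegralZr// kx.
Qed.
End marginals.

(** * A fixed-point theorem in the sup norm *)

Section sup_norm_contraction.
Context (R : realType) (X : Type).
Variables (P : (X -> R) -> Prop) (S : (X -> R) -> (X -> R)) (q E : R) (h0 : X -> R).
Hypotheses (q0 : 0 <= q) (q1 : q < 1) (Ph0 : P h0)
  (PS : forall h, P h -> P (S h))
  (P_closed : forall (u : nat -> X -> R) h (r : nat -> R), (forall n, P (u n)) ->
    r @ \oo --> 0 -> (forall n x, `|u n x - h x| <= r n) -> P h)
  (S_contraction : forall h h' (e : R), P h -> P h' -> (forall x, `|h x - h' x| <= e) ->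
    forall x, `|S h x - S h' x| <= q * e)
  (h0_E : forall x, `|S h0 x - h0 x| <= E).

Let u n := iter n S h0.
(* The geometric tail: the intervals of radius [r n] around [u n x] are nested,
   so the supremum of their left ends is a limit lying in all of them. *)
Let r n := q ^+ n * (E / (1 - q)).

Let Pu n : P (u n).
Proof. by elim: n => // n IH; exact: PS. Qed.

Let u_step n x : `|u n.+1 x - u n x| <= q ^+ n * E.
Proof.
elim: n x => [|n IH] x; first by rewrite expr0 mul1r h0_E.
by rewrite exprS -mulrA; exact: (S_contraction (Pu n.+1) (Pu n) IH).
Qed.

Let r_step n : r n = r n.+1 + q ^+ n * E.
Proof. by rewrite /r exprS; field; rewrite subr_eq0 gt_eqF. Qed.

Let r_ge0 n (x : X) : 0 <= r n.
Proof.
rewrite mulr_ge0 ?exprn_ge0// divr_ge0 ?subr_ge0 ?(ltW q1)//.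
exact: le_trans (h0_E x).
Qed.

Let lo x n := u n x - r n.
Let hi x n := u n x + r n.

Let lo_nd x : {homo lo x : m n / (m <= n)%N >-> m <= n}.
Proof.
apply: homo_leq => [//|? ? ?|n]; first exact: le_trans.
have := u_step n x; rewrite ler_norml /lo (r_step n) => /andP[+ _]; lra.
Qed.

Let hi_ni x : {homo hi x : m n / (m <= n)%N >-> n <= m}.
Proof.
apply: homo_leq => [//|? ? ? /[swap]|n]; first exact: le_trans.
have := u_step n x; rewrite ler_norml /hi (r_step n) => /andP[_]; lra.
Qed.

Let lo_hi x m n : lo x m <= hi x n.
Proof.
apply: (le_trans (lo_nd x (leq_maxl m n))).
apply: le_trans (hi_ni x (leq_maxr m n)).
by have := r_ge0 (maxn m n) x; rewrite /lo /hi; lra.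
Qed.

Let l x := sup (range (lo x)).

Let u_l n x : `|u n x - l x| <= r n.
Proof.
have hs : has_sup (range (lo x)).
  split; first by exists (lo x 0); exists 0%N.
  by exists (hi x 0%N) => _ [k _ <-]; exact: lo_hi.
have h1 : lo x n <= l x by apply: ub_le_sup; [exact: hs.2|exists n].
have h2 : l x <= hi x n.
  by apply: ge_sup; [exact: hs.1|move=> _ [k _ <-]; exact: lo_hi].
by rewrite ler_norml; apply/andP; move: h1 h2; rewrite /lo /hi; split; lra.
Qed.

Let r_cvg : r @ \oo --> 0.
Proof.
rewrite -(mul0r (E / (1 - q))); apply: cvgMr_tmp.
by apply: cvg_expr; rewrite ger0_norm.
Qed.

(** Banach's fixed-point theorem for functions on a bare type: completeness is
    replaced by the stability of [P] under uniform limits, so that [P] can contain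
    measurability and boundedness. *)
Lemma sup_norm_fixpoint : exists h, P h /\ forall x, S h x = h x.
Proof.
have Pl : P l by exact: P_closed Pu r_cvg (fun n x => u_l n x).
exists l; split => // x; apply/eqP; rewrite -subr_eq0 -normr_le0.
have b n : `|S l x - l x| <= 2 * r n.
  have h1 : `|S l x - S (u n) x| <= q * r n.
    by apply: S_contraction => // y; rewrite distrC u_l.
  have h2 : `|S (u n) x - l x| <= r n.+1 := u_l n.+1 x.
  have r1 : r n.+1 <= r n.
    by rewrite (r_step n) lerDl mulr_ge0 ?exprn_ge0// (le_trans _ (h0_E x)).
  have qr : q * r n <= r n by rewrite ler_piMl ?(r_ge0 _ x)// ltW.
  have := ler_distD (S (u n) x) (S l x) (l x); lra.
have cr2 : (fun n => 2 * r n) @ \oo --> (2 * 0 : R) by exact: cvgMl_tmp.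
rewrite -(mulr0 2) -(cvg_lim _ cr2)//.
by apply: limr_ge; [apply/cvg_ex; exists (2 * 0 : R)|exact: nearW].
Qed.

End sup_norm_contraction.

(** * Solving the optimality system *)

Section damped_step.
Context d1 d2 (T1 : measurableType d1) (T2 : measurableType d2) (R : realType).
Variables (m2 : {sigma_finite_measure set T2 -> \bar R}) (B : set T2).
Hypotheses (mB : measurable B) (fB : (m2 B < +oo)%E).
Variables (delta c : R) (f : T1 -> R) (K : T1 * T2 -> R).
Hypotheses (delta0 : 0 < delta) (c0 : 0 < c) (mf : measurable_fun setT f)
  (cf : forall x, c <= f x) (mK : measurable_fun setT K)
  (K0 : forall p, 0 <= K p).
Implicit Types (h : T1 -> R) (k : T2 -> R).

Local Notation beta := (fine (m2 B)).

Definition plan h k (p : T1 * T2) := Num.max delta (h p.1 + k p.2 - K p).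

(** Subtracting the residual of [f * (1 - h) = \int plan h k] divided by
    [f + beta]: since [plan] is nondecreasing and 1-Lipschitz in [h], the residual
    increases with slope between [f] and [f + beta] in [h], so that no step
    overshoots. *)
Definition damped_step h k (x : T1) : R :=
  h x - (f x * (h x - 1) + \int[m2]_(y in B) plan h k (x, y)) / (f x + beta).

Let beta0 : 0 <= beta. Proof. exact: fine_ge0. Qed.

Let f_beta x : 0 < f x + beta.
Proof. by rewrite ltr_wpDr// (lt_le_trans c0). Qed.

Lemma measurable_plan h k : measurable_fun setT h -> measurable_fun setT k ->
  measurable_fun setT (plan h k).
Proof.
move=> mh mk; apply: measurable_maxr => //.
apply: measurable_funB => //; apply: measurable_funD.
  exact: measurableT_comp.
exact: measurableT_comp.
Qed.

Lemma plan_bound (N1 N2 : R) h k p : (forall x, `|h x| <= N1) ->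
  (forall y, `|k y| <= N2) -> 0 <= plan h k p <= delta + N1 + N2.
Proof.
move=> hN1 hN2; rewrite /plan.
have := hN1 p.1; have := hN2 p.2; rewrite !ler_norml => /andP[? ?] /andP[? ?].
have Kp := K0 p; have d0 := delta0.
rewrite le_max (ltW delta0)/= ge_max; apply/andP; split; first by lra.
rewrite (le_trans (y := h p.1 + k p.2))//; first by rewrite gerBl.
by lra.
Qed.

Lemma integrable_plan_section (N1 N2 : R) h k x :
  measurable_fun setT h -> measurable_fun setT k ->
  (forall x, `|h x| <= N1) -> (forall y, `|k y| <= N2) ->
  m2.-integrable B (EFin \o (fun y => plan h k (x, y))).
Proof.
move=> mh mk hN1 hN2.
apply: (L2_integrable mB fB); apply: (L2_bounded mB fB (M := delta + N1 + N2)).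
  apply: measurable_funTS.
  exact: (measurableT_comp (measurable_plan mh mk)).
move=> y _; have /andP[h0 hN] := plan_bound (x, y) hN1 hN2.
by rewrite ger0_norm.
Qed.

(** Tonelli's theorem applies without integrability on the whole first space
    because [plan] is positive. *)
Lemma measurable_damped_step h k : measurable_fun setT h ->
  measurable_fun setT k -> measurable_fun setT (damped_step h k).
Proof.
move=> mh mk; apply: measurable_funB => //.
have mTB : measurable (@setT T1 `*` B) by exact: measurableX.
have mI : measurable_fun setT (fun x => \int[m2]_(y in B) plan h k (x, y)).
  apply: measurableT_comp => //.
  set G := (EFin \o plan h k) \_ (setT `*` B).
  rewrite (_ : (fun x => _) = fubini_F m2 G); last first.
    apply/funext => x; rewrite /fubini_F integral_mkcond; apply: eq_integral => y _.
    rewrite /G /patch/=; congr (if _ then _ else _).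
    by apply/idP/idP; rewrite !inE => //= -[].
  apply: measurable_fun_fubini_tonelli_F.
    apply/(measurable_restrictT _ mTB)/measurable_EFinP/measurable_funTS.
    exact: measurable_plan.
  move=> p; rewrite /G /patch/=; case: ifPn => // _.
  by rewrite lee_fin /plan le_max ltW.
apply: measurable_funM.
  by apply: measurable_funD => //; apply: measurable_funM => //; exact: measurable_funB.
by apply: measurable_fun_inv; exact: measurable_funD.
Qed.

Lemma damped_step_bounded (N1 N2 : R) h k :
  measurable_fun setT h -> measurable_fun setT k ->
  (forall x, `|h x| <= N1) -> (forall y, `|k y| <= N2) ->
  exists N, forall x, `|damped_step h k x| <= N.
Proof.
move=> mh mk hN1 kN2; exists (N1 + ((N1 + 1) + (delta + N1 + N2))) => x.
set I := \int[m2]_(y in B) plan h k (x, y).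
have i := integrable_plan_section x mh mk hN1 kN2.
have [I0 Ile] : 0 <= I /\ I <= (delta + N1 + N2) * beta.
  split.
    by apply: Rintegral_ge0 => y _; have /andP[] := plan_bound (x, y) hN1 kN2.
  rewrite -Rintegral_cst//; apply: le_Rintegral => //.
    exact: integrable_cst_lty.
  by move=> y _; have /andP[] := plan_bound (x, y) hN1 kN2.
rewrite /damped_step -/I; apply: le_trans (ler_normB _ _) _.
rewrite lerD// normrM normfV (ger0_norm (ltW (f_beta x))) ler_pdivrMr//.
apply: le_trans (ler_normD _ _) _; rewrite normrM (ger0_norm I0).
have fx : 0 <= f x by rewrite (le_trans (ltW c0)).
rewrite (ger0_norm fx).
have hx : `|h x - 1| <= N1 + 1.
  by apply: le_trans (ler_normB _ _) _; rewrite normr1 lerD2r.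
have := ler_wpM2l fx hx.
have D0 : 0 <= delta + N1 + N2.
  by have /andP[p0 pN] := plan_bound (x, point) hN1 kN2; exact: le_trans pN.
have N0 : 0 <= N1 + 1 by exact: le_trans hx.
have := mulr_ge0 beta0 N0; have := mulr_ge0 fx D0; move: Ile.
rewrite [leRHS]mulrDl !mulrDr; lra.
Qed.


(** Writing [a] for [h x - h' x], the difference of the two steps is
    [\int (a - (plan - plan')) / (f x + beta)]. Since [plan - plan'] lies between
    [0] and [a + (k y - k' y)], the integrand lies between [a] and [- (k y - k' y)],
    whose absolute values are at most [e]. *)
Lemma damped_step_contraction (N1 N2 N1' N2' e : R) h k h' k' x :
  measurable_fun setT h -> measurable_fun setT k ->
  measurable_fun setT h' -> measurable_fun setT k' ->
  (forall x, `|h x| <= N1) -> (forall y, `|k y| <= N2) ->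
  (forall x, `|h' x| <= N1') -> (forall y, `|k' y| <= N2') ->
  (forall x, `|h x - h' x| <= e) -> (forall y, `|k y - k' y| <= e) ->
  `|damped_step h k x - damped_step h' k' x| <= beta / (c + beta) * e.
Proof.
move=> mh mk mh' mk' hN1 hN2 hN1' hN2' e1 e2.
have i := integrable_plan_section x mh mk hN1 hN2.
have i' := integrable_plan_section x mh' mk' hN1' hN2'.
set a := h x - h' x.
have id : m2.-integrable B (EFin \o (fun y => plan h k (x, y) - plan h' k' (x, y))).
  by have := integrableB mB i i'; exact: eq_integrable.
have ia := integrable_cst_lty mB fB a.
have iad : m2.-integrable B
    (EFin \o (fun y => a - (plan h k (x, y) - plan h' k' (x, y)))).
  by have := integrableB mB ia id; exact: eq_integrable.
have -> : damped_step h k x - damped_step h' k' x =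
    (\int[m2]_(y in B) (a - (plan h k (x, y) - plan h' k' (x, y)))) /
    (f x + beta).
  rewrite RintegralB// RintegralB// Rintegral_cst// /damped_step /a.
  by field; rewrite gt_eqF.
have key : `|\int[m2]_(y in B) (a - (plan h k (x, y) - plan h' k' (x, y)))|
    <= e * beta.
  rewrite -Rintegral_cst//; apply: le_trans (le_normr_Rintegral _ _) _ => //.
  apply: le_Rintegral => //.
  - exact: integrable_norm iad.
  - exact: integrable_cst_lty.
  move=> y _; rewrite /plan /a /=; move: (K (x, y)) => kappa.
  have := e1 x; have := e2 y; rewrite !ler_norml => /andP[? ?] /andP[? ?].
  by rewrite /Num.max; case: ifPn; case: ifPn; rewrite -?leNgt => ? ?;
    apply/andP; split; lra.
have e0 : 0 <= e by exact: le_trans (e1 x).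
rewrite normrM normfV (ger0_norm (ltW (f_beta x))).
apply: (@le_trans _ _ (e * beta / (f x + beta))).
  by rewrite ler_wpM2r// invr_ge0 ltW.
rewrite -mulrA [leRHS]mulrC ler_wpM2l// ler_wpM2l//.
by rewrite lef_pV2 ?posrE// ?ltr_wpDr// lerD2r.
Qed.

End damped_step.

Section dual_system.
Context d1 d2 (T1 : measurableType d1) (T2 : measurableType d2) (R : realType).
Variables (m1 : {sigma_finite_measure set T1 -> \bar R})
  (m2 : {sigma_finite_measure set T2 -> \bar R}) (A : set T1) (B : set T2).
Hypotheses (mA : measurable A) (mB : measurable B)
  (fA : (m1 A < +oo)%E) (fB : (m2 B < +oo)%E).
Variables (delta c : R) (f : T1 -> R) (g : T2 -> R) (K : T1 * T2 -> R).
Hypotheses (delta0 : 0 < delta) (c0 : 0 < c)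
  (mf : measurable_fun setT f) (cf : forall x, c <= f x)
  (mg : measurable_fun setT g) (cg : forall x, c <= g x)
  (mK : measurable_fun setT K)
  (K0 : forall p, 0 <= K p).

Let K' (q : T2 * T1) := K (q.2, q.1).

Let mK' : measurable_fun setT K'.
Proof. by apply: measurableT_comp => //; exact: measurable_swap. Qed.

Let step (u : T1 + T2 -> R) (z : T1 + T2) : R :=
  match z with
  | inl x => damped_step m2 B delta f K (u \o inl) (u \o inr) x
  | inr y => damped_step m1 A delta g K' (u \o inr) (u \o inl) y
  end.

Let good (u : T1 + T2 -> R) : Prop :=
  [/\ measurable_fun setT (u \o inl), measurable_fun setT (u \o inr) &
      exists N, forall z, `|u z| <= N].

Let good_step u : good u -> good (step u).
Proof.
move=> [ml mr [N uN]]; split.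
- exact: (measurable_damped_step _ mB delta0 mf mK ml mr).
- exact: (measurable_damped_step _ mA delta0 mg mK' mr ml).
have lN x : `|(u \o inl) x| <= N by exact: uN.
have rN y : `|(u \o inr) y| <= N by exact: uN.
have [N1 sN1] := damped_step_bounded mB fB delta0 c0 cf mK K0 ml mr lN rN.
have [N2 sN2] := damped_step_bounded mA fA delta0 c0 cg mK'
  (fun=> K0 _) mr ml rN lN.
exists (Num.max N1 N2) => -[x|y]; rewrite le_max.
  by rewrite sN1.
by rewrite sN2 orbT.
Qed.

Let good_closed (u : nat -> T1 + T2 -> R) h (r : nat -> R) :
  (forall n, good (u n)) -> r @ \oo --> 0 ->
  (forall n z, `|u n z - h z| <= r n) -> good h.
Proof.
move=> gu r0 uh.
have cu z : u ^~ z @ \oo --> h z.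
  apply/cvgrPdist_le => /= e e0.
  have /cvgrPdist_le/(_ _ e0) := r0.
  apply: filterS => n /=; rewrite sub0r normrN => rn.
  by rewrite distrC (le_trans (uh n z))// (le_trans _ rn)// ler_norm.
split.
- apply: (@measurable_fun_cvg _ _ _ _ (fun n => u n \o inl)) => //.
    by move=> n; have [] := gu n.
  by move=> x _; exact: cu.
- apply: (@measurable_fun_cvg _ _ _ _ (fun n => u n \o inr)) => //.
    by move=> n; have [] := gu n.
  by move=> x _; exact: cu.
have [_ _ [N uN]] := gu 0%N; exists (N + r 0%N) => z.
have -> : h z = u 0%N z - (u 0%N z - h z) by ring.
by apply: le_trans (ler_normB _ _) _; rewrite lerD.
Qed.

(** A pair of functions on [T1] and [T2] is one function on [T1 + T2], on which
    both damped steps together contract the sup norm; a fixed point has zero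
    residuals. *)
Lemma dual_system_solution : exists (h : T1 -> R) (k : T2 -> R) (N : R),
  [/\ measurable_fun setT h /\ measurable_fun setT k,
      (forall x, `|h x| <= N) /\ (forall y, `|k y| <= N),
      forall x, \int[m2]_(y in B) plan delta K h k (x, y) = f x * (1 - h x) &
      forall y, \int[m1]_(x in A) plan delta K h k (x, y) = g y * (1 - k y)].
Proof.
pose bA := fine (m1 A); pose bB := fine (m2 B).
have bA0 : 0 <= bA by exact: fine_ge0.
have bB0 : 0 <= bB by exact: fine_ge0.
pose b := Num.max bA bB; pose q := b / (c + b).
have b0 : 0 <= b by rewrite le_max bA0.
have q0 : 0 <= q by rewrite divr_ge0// addr_ge0// ltW.
have q1 : q < 1 by rewrite ltr_pdivrMr ?mul1r ?ltrDr// ltr_wpDr.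
have qmono t : 0 <= t -> t <= b -> t / (c + t) <= q.
  move=> t0 tb; rewrite ler_pdivrMr ?ltr_wpDr// mulrAC ler_pdivlMr ?ltr_wpDr//.
  by rewrite !mulrDr [b * t]mulrC lerD2r; apply: ler_wpM2r => //; exact: ltW.
have g0 : good (cst 0).
  by split; [exact: measurable_cst..|exists 0 => z; rewrite normr0].
have [_ _ [E sE]] := good_step g0.
have [u [[ml mr [N uN]] su]] : exists u, good u /\ forall z, step u z = u z.
  apply: (sup_norm_fixpoint q0 q1 g0 good_step good_closed (E := E)).
  - move=> h h' e [ml mr [N hN]] [ml' mr' [N' hN']] hh' z.
    have e0 : 0 <= e by exact: le_trans (hh' z).
    case: z => [x|y] /=.
    + apply: (le_trans (damped_step_contraction mB fB delta0 c0 cf mK K0 x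
        ml mr ml' mr' (fun=> hN _) (fun=> hN _) (fun=> hN' _) (fun=> hN' _)
        (fun=> hh' _) (fun=> hh' _))).
      by rewrite ler_wpM2r// qmono// le_max lexx orbT.
    + apply: (le_trans (damped_step_contraction mA fA delta0 c0 cg mK'
        (fun=> K0 _) y
        mr ml mr' ml' (fun=> hN _) (fun=> hN _) (fun=> hN' _) (fun=> hN' _)
        (fun=> hh' _) (fun=> hh' _))).
      by rewrite ler_wpM2r// qmono// le_max lexx.
  - by move=> z; rewrite subr0; exact: sE.
exists (u \o inl), (u \o inr), N; split.
- by [].
- by split=> z; exact: uN.
- move=> x; have D0 : 0 < f x + bB by rewrite ltr_wpDr// (lt_le_trans c0 (cf x)).
  have /eqP := su (inl x).
  rewrite /= /damped_step -subr_eq0 addrAC subrr add0r oppr_eq0 mulf_eq0.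
  rewrite invr_eq0 (gt_eqF D0) orbF.
  by move=> /eqP /= h0; apply/eqP; rewrite -subr_eq0 -h0; apply/eqP; ring.
- move=> y; have D0 : 0 < g y + bA by rewrite ltr_wpDr// (lt_le_trans c0 (cg y)).
  have /eqP := su (inr y).
  rewrite /= /damped_step -subr_eq0 addrAC subrr add0r oppr_eq0 mulf_eq0.
  rewrite invr_eq0 (gt_eqF D0) orbF.
  rewrite (_ : Rintegral m1 A _ =
      \int[m1]_(x in A) plan delta K (u \o inl) (u \o inr) (x, y)).
    by move=> /eqP /= h0; apply/eqP; rewrite -subr_eq0 -h0; apply/eqP; ring.
  by apply: eq_Rintegral => x _; rewrite /plan /K' /= [u (inr y) + _]addrC.
Qed.

End dual_system.

(** * Borel sets of row vectors and continuity of the cost *)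

Section rV_borel.
Context (R : realType) (n : nat).
Local Notation Rn := 'rV[R]_n.

Lemma measurable_rV_ball (x : Rn) (e : R) : measurable (ball x e).
Proof.
have [e0|e0] := ltP 0 e; last first.
  rewrite (_ : ball x e = set0)//; apply/seteqP; split => // y [].
  by rewrite ltNge e0.
rewrite (_ : ball x e = \bigcap_(i in [set: 'I_n])
    (@rV_coord R n i @^-1` ball (x ord0 i) e)); last first.
  apply/seteqP; split => y /= => [[_ h] i _|h]; first exact: h.
  by split => // i j; rewrite (ord1 i); exact: h.
apply: fin_bigcap_measurable => // i _.
rewrite -[X in measurable X]setTI; apply: measurable_rV_coord => //.
by rewrite ball_itv; exact: measurable_itv.
Qed.

Definition rational_ball (c : 'rV[rat]_n * nat) : set Rn :=
  ball (map_mx ratr c.1 : Rn) c.2.+1%:R^-1.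

(** Countably many measurable balls form a base of the topology, which makes
    all open sets measurable, in the space and in its square. *)
Lemma rational_ball_base (x : Rn) (e : R) : 0 < e ->
  exists c, rational_ball c x /\ rational_ball c `<=` ball x e.
Proof.
move=> e0; have [m me] : exists m : nat, m.+1%:R^-1 < e / 2.
  exists (Num.truncn (e / 2)^-1); rewrite invf_plt ?posrE ?divr_gt0//.
  by rewrite truncnS_gt.
have m0 : 0 < m.+1%:R^-1 :> R by rewrite invr_gt0.
have /choice[q qP] : forall i, exists q : rat, `|x ord0 i - ratr q| < m.+1%:R^-1.
  move=> i; have /rat_in_itvoo[q] : x ord0 i - m.+1%:R^-1 < x ord0 i + m.+1%:R^-1.
    by rewrite ltrD2l gt0_cp.
  by rewrite in_itv/= => qi; exists q; rewrite ltr_distlC.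
pose c : 'rV[rat]_n * nat := (\row_i q i, m).
have xc : ball x m.+1%:R^-1 (map_mx ratr c.1 : Rn).
  by split => // i j; rewrite !mxE (ord1 i); exact: qP.
exists c; split; first exact: ball_sym.
move=> y cy; apply: (@le_ball _ _ _ (m.+1%:R^-1 + m.+1%:R^-1)).
  by rewrite [leRHS]splitr lerD// ltW.
exact: ball_triangle xc cy.
Qed.

Lemma open_rV_measurable (U : set Rn) : open U -> measurable U.
Proof.
move=> oU.
rewrite (_ : U = \bigcup_(c : 'rV[rat]_n * nat)
    (if `[< rational_ball c `<=` U >] then rational_ball c else set0)).
  apply: countable_bigcupT_measurable => // c.
  by case: ifPn => // _; exact: measurable_rV_ball.
apply/seteqP; split => [x Ux|x [c _]]; last first.
  by case: ifPn => // /asboolP; exact.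
have /nbhs_ballP[e /= e0 xeU] : nbhs x U by exact: open_nbhs_nbhs.
have [c [cx cU]] := rational_ball_base x e0.
exists c => //; rewrite ifT//; apply/asboolP; exact: subset_trans cU xeU.
Qed.

Lemma open_rV2_measurable (U : set (Rn * Rn)) : open U -> measurable U.
Proof.
move=> oU; pose b (c : ('rV[rat]_n * nat) * ('rV[rat]_n * nat)) :=
  rational_ball c.1 `*` rational_ball c.2.
rewrite (_ : U = \bigcup_c (if `[< b c `<=` U >] then b c else set0)).
  apply: countable_bigcupT_measurable => // c.
  by case: ifPn => // _; apply: measurableX; exact: measurable_rV_ball.
apply/seteqP; split => [x Ux|x [c _]]; last first.
  by case: ifPn => // /asboolP; exact.
have /nbhs_ballP[e /= e0 xeU] : nbhs x U by exact: open_nbhs_nbhs.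
have [c1 [cx1 cU1]] := rational_ball_base x.1 e0.
have [c2 [cx2 cU2]] := rational_ball_base x.2 e0.
exists (c1, c2) => //; rewrite ifT; first by split.
by apply/asboolP => y [y1 y2]; apply: xeU; split; [exact: cU1|exact: cU2].
Qed.

Lemma continuous_rV2_measurable (C : Rn * Rn -> R) : continuous C ->
  measurable_fun setT C.
Proof.
move=> cC; apply: (measurability _ (RGenOInfty.measurableE R)).
move=> _ [_ [a ->] <-]; rewrite setTI; apply: open_rV2_measurable.
by apply: open_comp => //; exact: open_gt.
Qed.

(** Inverting [L * r `^ alpha] gives the radius; [L] may be negative, hence the
    [`|L| + 1]. *)
Lemma locally_hoelder_continuous (V : normedModType R) (C : V -> R) :
  locally_hoelder C -> continuous C.
Proof.
move=> hC p; have [al [L [U [al0 _ pU CL]]]] := hC p.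
apply/cvgrPdist_le => e e0.
have L0 : 0 < `|L| + 1 by rewrite ltr_wpDl.
pose r := (e / (`|L| + 1)) `^ al^-1.
have r0 : 0 < r by rewrite powR_gt0// divr_gt0.
near=> q.
have Uq : U q by near: q.
have pq : `|p - q| <= r by near: q; exact: cvgr_dist_le.
apply: (le_trans (CL p q (nbhs_singleton pU) Uq)).
have pw : `|p - q| `^ al <= e / (`|L| + 1).
  apply: (@le_trans _ _ (r `^ al)); first by rewrite ge0_ler_powR ?nnegrE// ltW.
  by rewrite -powRrM mulVf ?gt_eqF// powRr1// divr_ge0// ltW.
apply: (@le_trans _ _ ((`|L| + 1) * (e / (`|L| + 1)))); last first.
  by rewrite mulrC divfK// gt_eqF.
apply: (@le_trans _ _ ((`|L| + 1) * `|p - q| `^ al)).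
  rewrite ler_wpM2r ?powR_ge0//; apply: (le_trans (ler_norm _)).
  by rewrite lerDl.
by rewrite ler_wpM2l// ltW.
Unshelve. all: by end_near. Qed.

End rV_borel.

(** * Duality on a rectangle *)

Section pearson_quadratic.
Context d (T : measurableType d) (R : realType).
Variables (m : {measure set T -> \bar R}) (D : set T).
Hypotheses (mD : measurable D) (fD : (m D < +oo)%E).
Variables (c M : R) (v : T -> R).
Hypotheses (c0 : 0 < c) (mv : measurable_fun setT v)
  (cv : forall x, c <= v x) (vM : forall x, v x <= M).
Implicit Types u w : T -> R.

Let v0 x : 0 < v x. Proof. exact: lt_le_trans (cv x). Qed.

Let Lv : L2 m D v.
Proof.
apply: (L2_bounded mD fD (M := M)); first exact: measurable_funTS.
by move=> x _; rewrite ger0_norm// ltW.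
Qed.

Lemma L2_add2 w : L2 m D w -> L2 m D (fun x => w x + 2).
Proof.
move=> Lw; apply: L2D => //.
by apply: (L2_bounded mD fD (M := 2)) => // x _; rewrite ger0_norm.
Qed.

Lemma integrable_pearson u : L2 m D u ->
  m.-integrable D (EFin \o (fun x => (u x / v x - 1) ^+ 2 * v x)).
Proof.
move=> Lu.
have iuv := integrable_sqr_div mD c0 (measurable_funTS mv) (fun x _ => cv x) Lu.
have iu := L2_integrable mD fD Lu; have iv := L2_integrable mD fD Lv.
have := integrableD mD (integrableB mD iuv (integrableZl mD 2 iu)) iv.
apply: eq_integrable => // x _ /=; congr (_%:E); field.
by rewrite gt_eqF.
Qed.

(** Expanding the square turns the Pearson integrand into a quadratic in [u];
    its linear term accounts for the [+ 2]. *)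
Lemma pearson_quad_int w u : L2 m D w -> L2 m D u ->
  quad_int m D v (fun x => w x + 2) v u =
  \int[m]_(x in D) (u x * w x) - \int[m]_(x in D) ((u x / v x - 1) ^+ 2 * v x).
Proof.
move=> Lw Lu; rewrite -RintegralB//; last 2 first.
- exact: L2_mul_integrable.
- exact: integrable_pearson.
by apply: eq_Rintegral => x _; rewrite /quad; field; rewrite gt_eqF.
Qed.

End pearson_quadratic.

Section rectangle_duality.
Context d1 d2 (T1 : measurableType d1) (T2 : measurableType d2) (R : realType).
Variables (m1 : {sigma_finite_measure set T1 -> \bar R})
  (m2 : {sigma_finite_measure set T2 -> \bar R}) (A : set T1) (B : set T2).
Hypotheses (mA : measurable A) (mB : measurable B)
  (fA : (m1 A < +oo)%E) (fB : (m2 B < +oo)%E).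
Variables (delta c M N : R) (F : T1 -> R) (G : T2 -> R) (K : T1 * T2 -> R).
Hypotheses (delta0 : 0 < delta) (c0 : 0 < c)
  (mF : measurable_fun setT F) (cF : forall x, c <= F x) (FM : forall x, F x <= M)
  (mG : measurable_fun setT G) (cG : forall x, c <= G x) (GM : forall x, G x <= M)
  (mK : measurable_fun setT K) (K0 : forall p, 0 <= K p) (KN : forall p, K p <= N).
Local Notation m12 := (m1 \x m2)%E.
Local Notation Om := (A `*` B).
Local Notation theta1 := (delta * fine (m2 B)).
Local Notation theta2 := (delta * fine (m1 A)).
Implicit Types (k : T1 * T2 -> R).

Definition marg1 k := slice_marginal m2 B (fun x y => (x, y)) k.
Definition marg2 k := slice_marginal m1 A (fun y x => (x, y)) k.

(** The primal and dual objectives as real numbers; in the dual one the suprema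
    are already replaced by the integrals of their pointwise maximizers. *)
Definition primal_real k : R :=
  \int[m12]_(p in Om) (K p * k p) + 2^-1 * \int[m12]_(p in Om) k p ^+ 2
  + 2^-1 * \int[m1]_(x in A) ((marg1 k x / F x - 1) ^+ 2 * F x)
  + 2^-1 * \int[m2]_(y in B) ((marg2 k y / G y - 1) ^+ 2 * G y).

Definition tilt (h : (T1 -> R) * (T2 -> R)) (p : T1 * T2) : R :=
  h.1 p.1 + h.2 p.2 - K p.

Definition cost_quad_int h k := quad_int m12 Om (cst 2) (tilt h) (cst 0) k.
Definition quad_int1 (h : T1 -> R) u := quad_int m1 A F (fun x => - 2 * h x + 2) F u.
Definition quad_int2 (h : T2 -> R) u := quad_int m2 B G (fun x => - 2 * h x + 2) G u.

Definition best_plan h := quad_argmax delta (cst 2) (tilt h).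
Definition best_marg1 (h : T1 -> R) := quad_argmax theta1 F (fun x => - 2 * h x + 2).
Definition best_marg2 (h : T2 -> R) := quad_argmax theta2 G (fun x => - 2 * h x + 2).

Definition dual_real (h : (T1 -> R) * (T2 -> R)) : R :=
  cost_quad_int h (best_plan h) + 2^-1 * quad_int1 h.1 (best_marg1 h.1)
  + 2^-1 * quad_int2 h.2 (best_marg2 h.2).

Let mOm : measurable Om. Proof. exact: measurableX. Qed.

Let fOm : (m12 Om < +oo)%E.
Proof.
rewrite product_measure1E// lte_mul_pinfty// ge0_fin_numE//.
Qed.

Let F0 x : 0 < F x. Proof. exact: lt_le_trans (cF x). Qed.
Let G0 y : 0 < G y. Proof. exact: lt_le_trans (cG y). Qed.

Let LK : L2 m12 Om K.
Proof.
apply: (L2_bounded mOm fOm (M := N)); first exact: measurable_funTS.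
by move=> p _; rewrite ger0_norm.
Qed.

Lemma L2_tilt (h : (T1 -> R) * (T2 -> R)) : L2 m1 A h.1 -> L2 m2 B h.2 ->
  L2 m12 Om (tilt h).
Proof.
move=> L1 L2'; apply: L2B => //; apply: L2D => //.
  exact: L2_rectangle_fst.
exact: L2_rectangle_snd.
Qed.

Lemma L2_marg1 k : L2 m12 Om k -> L2 m1 A (marg1 k).
Proof. exact: (L2_slice_marginal mOm mA mB fOm fB (Fubini_rectangle_x mA mB)). Qed.

Lemma L2_marg2 k : L2 m12 Om k -> L2 m2 B (marg2 k).
Proof. exact: (L2_slice_marginal mOm mB mA fOm fA (Fubini_rectangle_y mA mB)). Qed.

Lemma L2_ge_marg1 k : L2_ge m12 delta Om k -> L2_ge m1 theta1 A (marg1 k).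
Proof.
move=> kd; split; first exact: L2_marg1 kd.1.
exact: (slice_marginal_ge mOm mA mB fOm fB (Fubini_rectangle_x mA mB) kd).
Qed.

Lemma L2_ge_marg2 k : L2_ge m12 delta Om k -> L2_ge m2 theta2 B (marg2 k).
Proof.
move=> kd; split; first exact: L2_marg2 kd.1.
exact: (slice_marginal_ge mOm mB mA fOm fA (Fubini_rectangle_y mA mB) kd).
Qed.

Lemma cost_quad_intE k h : L2 m12 Om k -> L2 m1 A h.1 -> L2 m2 B h.2 ->
  cost_quad_int h k = \int[m12]_(p in Om) (k p * (h.1 p.1 + h.2 p.2))
    - \int[m12]_(p in Om) (K p * k p) - 2^-1 * \int[m12]_(p in Om) k p ^+ 2.
Proof.
move=> Lk Lh1 Lh2.
have ih : m12.-integrable Om (EFin \o (fun p => k p * (h.1 p.1 + h.2 p.2))).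
  apply: (L2_mul_integrable mOm Lk); apply: L2D => //.
    exact: L2_rectangle_fst.
  exact: L2_rectangle_snd.
have iK := L2_mul_integrable mOm LK Lk.
have [_ ik2] := (L2P _ mOm _).1 Lk.
have ihK : m12.-integrable Om
    (EFin \o (fun p => k p * (h.1 p.1 + h.2 p.2) - K p * k p)).
  by have := integrableB mOm ih iK; exact: eq_integrable.
have ik : m12.-integrable Om (EFin \o (fun p => 2^-1 * k p ^+ 2)).
  by have := integrableZl mOm 2^-1 ik2; exact: eq_integrable.
rewrite -RintegralZl// -RintegralB// -RintegralB//.
by apply: eq_Rintegral => p _; rewrite /quad /tilt /=; ring.
Qed.

(** By Fubini's theorem the pairing of [k] with [h.1 + h.2] is the sum of the
    pairings of the marginals with [h.1] and [h.2]; the factors [- 2] and [2^-1]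
    make them cancel, leaving the losses of [k] and of its marginals with respect
    to the three maximizers. *)
Lemma duality_gapE k h : L2 m12 Om k -> L2 m1 A h.1 -> L2 m2 B h.2 ->
  primal_real k + dual_real h =
  (cost_quad_int h (best_plan h) - cost_quad_int h k)
  + 2^-1 * (quad_int1 h.1 (best_marg1 h.1) - quad_int1 h.1 (marg1 k))
  + 2^-1 * (quad_int2 h.2 (best_marg2 h.2) - quad_int2 h.2 (marg2 k)).
Proof.
move=> Lk Lh1 Lh2.
have L1 := L2_rectangle_fst mA mB fB Lh1.
have L2' := L2_rectangle_snd mA mB fA Lh2.
have e1 : \int[m12]_(p in Om) (k p * h.1 p.1) =
    \int[m1]_(x in A) (marg1 k x * h.1 x) :=
  Rintegral_slice_marginalM mOm mA mB fOm fB (Fubini_rectangle_x mA mB)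
  (pi := fst)
  (fun _ _ => erefl) ((L2P _ mA _).1 Lh1).1 Lk L1.
have e2 : \int[m12]_(p in Om) (k p * h.2 p.2) =
    \int[m2]_(y in B) (marg2 k y * h.2 y) :=
  Rintegral_slice_marginalM mOm mB mA fOm fA (Fubini_rectangle_y mA mB)
  (pi := snd)
  (fun _ _ => erefl) ((L2P _ mB _).1 Lh2).1 Lk L2'.
rewrite {2}/quad_int1 {2}/quad_int2.
have pull d (T : measurableType d) (m : {measure set T -> \bar R}) (D : set T)
    (u w : T -> R) : measurable D -> L2 m D u -> L2 m D w ->
    \int[m]_(x in D) (u x * (- 2 * w x)) = - 2 * \int[m]_(x in D) (u x * w x).
  move=> mD Lu Lw; rewrite -RintegralZl//; last exact: L2_mul_integrable.
  by apply: eq_Rintegral => x _; ring.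
have Lk1 := L2_marg1 Lk; have Lk2 := L2_marg2 Lk.
rewrite (pearson_quad_int mA fA c0 mF cF FM (L2Z mA (- 2) Lh1) Lk1).
rewrite (pearson_quad_int mB fB c0 mG cG GM (L2Z mB (- 2) Lh2) Lk2).
rewrite !pull// -e1 -e2.
rewrite (cost_quad_intE Lk Lh1 Lh2).
have -> : \int[m12]_(p in Om) (k p * (h.1 p.1 + h.2 p.2)) =
    \int[m12]_(p in Om) (k p * h.1 p.1) + \int[m12]_(p in Om) (k p * h.2 p.2).
  rewrite -RintegralD//; [|exact: L2_mul_integrable..].
  by apply: eq_Rintegral => p _; rewrite mulrDr.
by rewrite /primal_real /dual_real; field.
Qed.

Let quad_gaps k h : L2_ge m12 delta Om k -> L2 m1 A h.1 -> L2 m2 B h.2 ->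
  [/\ (cost_quad_int h k <= cost_quad_int h (best_plan h)) /\
      (cost_quad_int h k = cost_quad_int h (best_plan h) <->
       \forall p \ae m12, Om p -> k p = best_plan h p),
      (quad_int1 h.1 (marg1 k) <= quad_int1 h.1 (best_marg1 h.1)) /\
      (quad_int1 h.1 (marg1 k) = quad_int1 h.1 (best_marg1 h.1) <->
       \forall x \ae m1, A x -> marg1 k x = best_marg1 h.1 x) &
      (quad_int2 h.2 (marg2 k) <= quad_int2 h.2 (best_marg2 h.2)) /\
      (quad_int2 h.2 (marg2 k) = quad_int2 h.2 (best_marg2 h.2) <->
       \forall y \ae m2, B y -> marg2 k y = best_marg2 h.2 y)].
Proof.
move=> kd Lh1 Lh2.
have two0 : 0 < 2 :> R by [].
have Lt := L2_tilt Lh1 Lh2.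
have Ls1 := L2_add2 mA fA (L2Z mA (- 2) Lh1).
have Ls2 := L2_add2 mB fB (L2Z mB (- 2) Lh2).
have kd1 := L2_ge_marg1 kd; have kd2 := L2_ge_marg2 kd.
have cst0 p : Om p -> `|cst 0 p : R| <= 0 by rewrite normr0.
have cst2 p : Om p -> 2 <= (cst 2 p : R) by [].
have cst2' p : Om p -> (cst 2 p : R) <= 2 by [].
have mc0 : measurable_fun Om (cst (0 : R)) by exact: measurable_cst.
have mc2 : measurable_fun Om (cst (2 : R)) by exact: measurable_cst.
have mF' := measurable_funTS mF (D := A); have mG' := measurable_funTS mG (D := B).
have nF x : A x -> `|F x| <= M by rewrite gtr0_norm.
have nG y : B y -> `|G y| <= M by rewrite gtr0_norm.
split; split.
- exact: (quad_int_le mOm fOm two0 mc2 cst2 cst2' Lt mc0 cst0 kd).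
- exact: (quad_int_max_ae mOm fOm two0 mc2 cst2 cst2' Lt mc0 cst0 kd).
- exact: (quad_int_le mA fA c0 mF' (fun x _ => cF x) (fun x _ => FM x) Ls1 mF' nF kd1).
- exact: (quad_int_max_ae mA fA c0 mF' (fun x _ => cF x) (fun x _ => FM x) Ls1 mF' nF kd1).
- exact: (quad_int_le mB fB c0 mG' (fun x _ => cG x) (fun x _ => GM x) Ls2 mG' nG kd2).
- exact: (quad_int_max_ae mB fB c0 mG' (fun x _ => cG x) (fun x _ => GM x) Ls2 mG' nG kd2).
Qed.

Lemma weak_duality k h : L2_ge m12 delta Om k -> L2 m1 A h.1 -> L2 m2 B h.2 ->
  0 <= primal_real k + dual_real h.
Proof.
move=> kd Lh1 Lh2; rewrite (duality_gapE kd.1 Lh1 Lh2).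
have [[le0 _] [le1 _] [le2 _]] := quad_gaps kd Lh1 Lh2; lra.
Qed.

Lemma duality_gap_eq0 k h : L2_ge m12 delta Om k -> L2 m1 A h.1 -> L2 m2 B h.2 ->
  primal_real k + dual_real h = 0 <->
  [/\ \forall p \ae m12, Om p -> k p = best_plan h p,
      \forall x \ae m1, A x -> marg1 k x = best_marg1 h.1 x &
      \forall y \ae m2, B y -> marg2 k y = best_marg2 h.2 y].
Proof.
move=> kd Lh1 Lh2; rewrite (duality_gapE kd.1 Lh1 Lh2).
have [[le0 eq0] [le1 eq1] [le2 eq2]] := quad_gaps kd Lh1 Lh2.
split => [gap|[/eq0 -> /eq1 -> /eq2 ->]]; last by ring.
by split; [apply/eq0|apply/eq1|apply/eq2]; lra.
Qed.

(** For a solution of the optimality system, the first marginal of the plan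
    equals [F * (1 - h1)], and it is at least [delta] times the measure of [B] as the
    plan is at least [delta]; so truncating [F * (1 - h1)] from below at that level
    changes nothing. The second marginal is similar. *)
Lemma zero_gap_pair : exists k h,
  [/\ L2_ge m12 delta Om k, L2 m1 A h.1, L2 m2 B h.2 &
      primal_real k + dual_real h = 0].
Proof.
have [h1 [h2 [N' [[mh1 mh2] [h1N h2N] eq1 eq2]]]] :=
  dual_system_solution mA mB fA fB delta0 c0 mF cF mG cG mK K0.
have Lh1 : L2 m1 A h1.
  by apply: (L2_bounded mA fA (M := N')) => //; exact: measurable_funTS.
have Lh2 : L2 m2 B h2.
  by apply: (L2_bounded mB fB (M := N')) => //; exact: measurable_funTS.
pose k := plan delta K h1 h2.
have kd : L2_ge m12 delta Om k.
  split; last by apply: aeW => p _; rewrite /k /plan le_max lexx.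
  have := L2_max mOm fOm delta (L2_tilt (h := (h1, h2)) Lh1 Lh2).
  by [].
exists k, (h1, h2); split => //.
apply/(duality_gap_eq0 (h := (h1, h2)) kd Lh1 Lh2); split.
- apply: aeW => p _; rewrite /k /plan /best_plan /quad_argmax /tilt/=.
  by congr Num.max; field.
- have [_ kge] := L2_ge_marg1 kd; apply: filterS kge => x kge Ax.
  have e : marg1 k x = F x * (1 - h1 x) by exact: eq1.
  have -> : best_marg1 h1 x = Num.max theta1 (F x * (1 - h1 x)).
    by rewrite /best_marg1 /quad_argmax; congr Num.max; field.
  by rewrite max_r -e// kge.
- have [_ kge] := L2_ge_marg2 kd; apply: filterS kge => y kge By.
  have e : marg2 k y = G y * (1 - h2 y) by exact: eq2.
  have -> : best_marg2 h2 y = Num.max theta2 (G y * (1 - h2 y)).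
    by rewrite /best_marg2 /quad_argmax; congr Num.max; field.
  by rewrite max_r -e// kge.
Qed.

End rectangle_duality.

(** * The data of the transport problem *)

Section problem_data.
Context (R : realType) (n : nat).
Local Notation Rn := 'rV[R]_n.
Local Notation leb := (@lebesgue_rV R n).
Local Notation leb2 := (leb \x leb)%E.
Implicit Types (f v u : Rn -> R).

Lemma measurable_supp f : measurable (supp f).
Proof.
apply: measurableC; apply: open_rV_measurable; apply: bigcup_open.
by move=> U [].
Qed.

Lemma Lfun_infty_ub d (T : measurableType d) (m : {measure set T -> \bar R})
    (u : T -> R) : u \in Lfun m +oo%E -> exists N, \forall x \ae m, u x <= N.
Proof.
rewrite inE => /andP[_]; rewrite inE/= /finite_norm unlock.
case: ifPn => [_|].
  rewrite (_ : (abse \o (EFin \o u))%E = EFin \o (Num.norm \o u))//.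
  move=> /ess_supr_bounded[N uN]; exists N.
  by apply: filterS uN => x; apply: le_trans; exact: ler_norm.
rewrite -leNgt measure_le0 => /eqP mT _; exists 0.
by exists setT; split.
Qed.

(** Truncating a density between its lower bound and an essential upper bound
    gives bounds valid everywhere, at the price of a null set of the support. *)
Lemma density_representative (c : R) f : 0 < c -> Moo c f ->
  exists F M, [/\ measurable_fun setT F, forall x, c <= F x, forall x, F x <= M &
    \forall x \ae leb, supp f x -> f x = F x].
Proof.
move=> c0 [Lf _ cf]; have [N fN] := Lfun_infty_ub Lf.
have mf : measurable_fun setT f by move: Lf; rewrite inE => /andP[]; rewrite inE.
exists (fun x => Num.min (Num.max c (f x)) (Num.max c N)), (Num.max c N); split.
- by apply: measurable_minr => //; exact: measurable_maxr.
- by move=> x; rewrite le_min !le_max lexx.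
- by move=> x; rewrite ge_min lexx orbT.
apply: filterS2 cf fN => x cf fN fx.
by rewrite max_r ?cf// min_l// le_max fN orbT.
Qed.

(** A continuous cost is bounded on the compact set [Om], where truncating it at
    such a bound has no effect. *)
Lemma cost_representative (C : Rn * Rn -> R) (Om : set (Rn * Rn)) :
  (forall p, 0 <= C p) -> locally_hoelder C -> compact Om ->
  exists (K : Rn * Rn -> R) (N : R),
    [/\ measurable_fun setT K, forall p, 0 <= K p, forall p, K p <= N &
    forall p, Om p -> C p = K p].
Proof.
move=> C0 /locally_hoelder_continuous cC cOm.
have mC := continuous_rV2_measurable cC.
have : compact (C @` Om : set R^o).
  by apply: continuous_compact => //; exact: continuous_subspaceT.
move=> /compact_bounded[N [_ CN]].
have {}CN p : Om p -> C p <= `|N| + 1.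
  move=> Op; apply: le_trans (ler_norm _) _.
  by apply: (CN (`|N| + 1)); [rewrite ltr_pwDr// ler_norm|exists p].
exists (fun p => Num.min (C p) (`|N| + 1)), (`|N| + 1); split.
- exact: measurable_minr.
- by move=> p; rewrite le_min C0 addr_ge0.
- by move=> p; rewrite ge_min lexx orbT.
- by move=> p Op; rewrite min_l// CN.
Qed.

Section pearson_values.
Variables (c M : R) (f F : Rn -> R).
Local Notation A := (supp f).
Hypotheses (fA : (leb A < +oo)%E) (c0 : 0 < c) (mf : measurable_fun setT f)
  (mF : measurable_fun setT F) (cF : forall x, c <= F x) (FM : forall x, F x <= M)
  (fF : \forall x \ae leb, A x -> f x = F x).

Let mA := measurable_supp f.

Lemma pearsonE u : L2 leb A u ->
  pearson u f = (\int[leb]_(x in A) ((u x / F x - 1) ^+ 2 * F x))%:E.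
Proof.
move=> Lu; have [mu _] := (L2P _ mA _).1 Lu.
rewrite -integral_EFin_Rintegral//; last exact: (integrable_pearson mA fA c0 mF cF FM).
have mfA := measurable_funTS mf (D := A); have mFA := measurable_funTS mF (D := A).
apply: ae_eq_integral => //.
- apply/measurable_EFinP; apply: measurable_funM => //; apply: measurable_funX.
  by apply: measurable_funB => //; apply: measurable_funM => //; exact: measurable_fun_inv.
- apply/measurable_EFinP; apply: measurable_funM => //; apply: measurable_funX.
  by apply: measurable_funB => //; apply: measurable_funM => //; exact: measurable_fun_inv.
by apply: filterS fF => x fFx Ax; rewrite fFx.
Qed.

Lemma pearson_conjE (theta : R) u' : L2 leb A u' ->
  pearson_conj theta u' f =
  (quad_int leb A F (fun x => u' x + 2) F
    (quad_argmax theta F (fun x => u' x + 2)))%:E.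
Proof.
move=> Lu'; have mFA := measurable_funTS mF (D := A).
have FnM x : A x -> `|F x| <= M.
  by move=> _; rewrite gtr0_norm// (lt_le_trans c0).
rewrite -(ereal_sup_quad mA fA theta c0 mFA (fun x _ => cF x) (fun x _ => FM x)
  (L2_add2 mA fA Lu') mFA FnM).
rewrite /pearson_conj; congr ereal_sup; apply: eq_imagel => u [Lu _].
rewrite (pearson_quad_int mA fA c0 mF cF FM Lu' Lu) EFinB pearsonE//.
by rewrite integral_EFin_Rintegral//; exact: L2_mul_integrable.
Qed.

End pearson_values.

End problem_data.

(** * Conclusion *)

(** If the sum of two objectives is nonnegative and vanishes for some pair, that
    pair consists of minimizers, and the vanishing of the sum characterizes all
    pairs of minimizers. *)
Lemma minimizers_of_zero_gap (R : realType) (X Y : Type) (D1 : set X) (D2 : set Y)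
    (J1 : X -> \bar R) (J2 : Y -> \bar R) (j1 : X -> R) (j2 : Y -> R) :
  (forall x, D1 x -> J1 x = (j1 x)%:E) -> (forall y, D2 y -> J2 y = (j2 y)%:E) ->
  (forall x y, D1 x -> D2 y -> 0 <= j1 x + j2 y) ->
  (exists x y, [/\ D1 x, D2 y & j1 x + j2 y = 0]) ->
  [/\ exists x, is_minimizer D1 J1 x, exists y, is_minimizer D2 J2 y,
      forall x y, D1 x -> D2 y ->
        (is_minimizer D1 J1 x /\ is_minimizer D2 J2 y <-> j1 x + j2 y = 0) &
      (ereal_inf (J1 @` D1) + ereal_inf (J2 @` D2) = 0)%E].
Proof.
move=> J1E J2E gap [x0 [y0 [Dx0 Dy0 gap0]]].
have min_of_gap x y : D1 x -> D2 y -> j1 x + j2 y = 0 ->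
    is_minimizer D1 J1 x /\ is_minimizer D2 J2 y.
  move=> Dx Dy xy0; split; split => // z Dz.
    by rewrite !J1E// lee_fin; have := gap z y Dz Dy; lra.
  by rewrite !J2E// lee_fin; have := gap x z Dx Dz; lra.
have [minx0 miny0] := min_of_gap _ _ Dx0 Dy0 gap0.
have infE Z (D : set Z) (J : Z -> \bar R) z : is_minimizer D J z ->
    ereal_inf (J @` D) = J z.
  move=> [Dz Jz]; apply/eqP; rewrite eq_le; apply/andP; split.
    by apply: ereal_inf_lbound; exists z.
  by apply: le_ereal_inf_tmp => _ [z' Dz' <-]; exact: Jz.
split.
- by exists x0.
- by exists y0.
- move=> x y Dx Dy; split; last exact: min_of_gap.
  move=> [[_ /(_ _ Dx0)] + [_ /(_ _ Dy0)]].
  rewrite !J1E// !J2E// !lee_fin => h1 h2.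
  by have := gap x y Dx Dy; lra.
- rewrite (infE _ _ _ _ minx0) (infE _ _ _ _ miny0) J1E// J2E//.
  by rewrite -EFinD gap0.
Qed.

Section regularized_transport.
Context (R : realType) (n : nat).
Local Notation Rn := 'rV[R]_n.
Local Notation leb := (@lebesgue_rV R n).
Local Notation leb2 := (leb \x leb)%E.
Variables (c delta M N : R) (f g F G : Rn -> R) (C K : Rn * Rn -> R).
Local Notation A := (supp f).
Local Notation B := (supp g).
Local Notation Om := (A `*` B).
Hypotheses (c0 : 0 < c) (delta0 : 0 < delta)
  (fA : (leb A < +oo)%E) (fB : (leb B < +oo)%E)
  (mf : measurable_fun setT f) (mF : measurable_fun setT F)
  (cF : forall x, c <= F x) (FM : forall x, F x <= M)
  (fF : \forall x \ae leb, A x -> f x = F x)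
  (mg : measurable_fun setT g) (mG : measurable_fun setT G)
  (cG : forall x, c <= G x) (GM : forall x, G x <= M)
  (gG : \forall x \ae leb, B x -> g x = G x)
  (mK : measurable_fun setT K) (K0 : forall p, 0 <= K p) (KN : forall p, K p <= N)
  (CK : forall p, Om p -> C p = K p).

Let mA : measurable A. Proof. exact: measurable_supp. Qed.
Let mB : measurable B. Proof. exact: measurable_supp. Qed.
Let mOm : measurable Om. Proof. exact: measurableX. Qed.
Let fOm : (leb2 Om < +oo)%E.
Proof. by rewrite product_measure1E// lte_mul_pinfty// ge0_fin_numE. Qed.

Let integral_CkE k : L2 leb2 Om k ->
  (\int[leb2]_(p in Om) (C p * k p)%:E)%E = (\int[leb2]_(p in Om) (K p * k p))%:E.
Proof.
move=> Lk; rewrite -integral_EFin_Rintegral//; last first.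
  apply: (L2_mul_integrable mOm) => //; apply: (L2_bounded mOm fOm (M := N)).
    exact: measurable_funTS.
  by move=> p _; rewrite ger0_norm.
by apply: eq_integral => p /set_mem Op; rewrite CK.
Qed.

Lemma primal_objE k : L2 leb2 Om k ->
  primal_obj C f g k = (primal_real leb leb A B F G K k)%:E.
Proof.
move=> Lk; rewrite /primal_obj integral_CkE// (sqr_L2normE mOm Lk).
rewrite (pearsonE fA c0 mf mF cF FM fF (L2_marg1 mA mB fA fB Lk)).
by rewrite (pearsonE fB c0 mg mG cG GM gG (L2_marg2 mA mB fA fB Lk)).
Qed.

Lemma cost_conjE (h : (Rn -> R) * (Rn -> R)) : L2 leb A h.1 -> L2 leb B h.2 ->
  cost_conj delta C Om (fun p => h.1 p.1 + h.2 p.2) =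
  (cost_quad_int leb leb A B K h (best_plan delta K h))%:E.
Proof.
move=> Lh1 Lh2; have two0 : 0 < 2 :> R by [].
rewrite /cost_quad_int /best_plan -(@ereal_sup_quad _ _ _ _ _ mOm fOm _ 2 2 0)//;
  last 2 first.
- exact: (L2_tilt mA mB fA fB mK K0 KN).
- by move=> p _; rewrite normr0.
rewrite /cost_conj; congr ereal_sup; apply: eq_imagel => k [Lk _].
rewrite -/(cost_quad_int leb leb A B K h k)
  (cost_quad_intE mA mB fA fB mK K0 KN Lk Lh1 Lh2).
rewrite integral_CkE// (sqr_L2normE mOm Lk) integral_EFin_Rintegral//.
apply: L2_mul_integrable => //; apply: L2D => //.
  exact: L2_rectangle_fst.
exact: L2_rectangle_snd.
Qed.

Lemma dual_objE (h : (Rn -> R) * (Rn -> R)) : L2 leb A h.1 -> L2 leb B h.2 ->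
  dual_obj delta C f g h = (dual_real leb leb A B delta F G K h)%:E.
Proof.
move=> Lh1 Lh2; rewrite /dual_obj cost_conjE//.
rewrite (pearson_conjE fA c0 mf mF cF FM fF _ (L2Z mA (- 2) Lh1)).
by rewrite (pearson_conjE fB c0 mg mG cG GM gG _ (L2Z mB (- 2) Lh2)).
Qed.

Lemma best_planE k (h : (Rn -> R) * (Rn -> R)) :
  (\forall p \ae leb2, Om p -> k p = best_plan delta K h p) <->
  (\forall p \ae leb2, Om p -> k p = Num.max delta (h.1 p.1 + h.2 p.2 - C p)).
Proof.
have e p : Om p -> best_plan delta K h p = Num.max delta (h.1 p.1 + h.2 p.2 - C p).
  move=> Op; rewrite CK// /best_plan /quad_argmax /tilt /=.
  by congr Num.max; field.
by split; apply: filterS => p kp Op; rewrite kp// e.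
Qed.

(** Multiplying by the positive density turns the maximum of the statement into
    the constrained maximizer. *)
Let marginal_densityE (theta : R) (D : set Rn) (v V h u : Rn -> R) :
  (forall x, c <= V x) -> (\forall x \ae leb, D x -> v x = V x) ->
  (\forall x \ae leb, D x -> u x = quad_argmax theta V (fun x => - 2 * h x + 2) x) <->
  (\forall x \ae leb, D x -> u x = v x * Num.max (theta / v x) (1 - h x)).
Proof.
move=> cV vV.
have e x : quad_argmax theta V (fun x => - 2 * h x + 2) x =
    V x * Num.max (theta / V x) (1 - h x).
  have V0 : 0 < V x by exact: lt_le_trans (cV x).
  rewrite /quad_argmax maxr_pMr ?ltW// [V x * (theta / _)]mulrC divfK ?gt_eqF//.
  by congr Num.max; field.
by split; apply: filterS2 vV => x vV ux Dx; rewrite ux// e vV.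
Qed.

Lemma regularized_duality :
  [/\ exists k, is_minimizer (primal_dom delta f g) (primal_obj C f g) k,
      exists h, is_minimizer (dual_dom f g) (dual_obj delta C f g) h,
      forall (k : Rn * Rn -> R) (k1 k2 : Rn -> R),
        L2 leb2 Om k -> L2 leb A k1 -> L2 leb B k2 ->
        (is_minimizer (primal_dom delta f g) (primal_obj C f g) k /\
         is_minimizer (dual_dom f g) (dual_obj delta C f g) (k1, k2))
        <->
        [/\ \forall p \ae leb2, Om p ->
              k p = Num.max delta (k1 p.1 + k2 p.2 - C p),
            \forall x \ae leb, A x -> marginal_x B k x =
                f x * Num.max (delta * vol B / f x) (1 - k1 x) &
            \forall y \ae leb, B y -> marginal_y A k y =
                g y * Num.max (delta * vol A / g y) (1 - k2 y)] &
      (primal_value delta C f g + dual_value delta C f g = 0)%E].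
Proof.
have gap0 := duality_gap_eq0 mA mB fA fB c0 mF cF FM mG cG GM mK K0 KN.
have [exk exh minP inf0] := @minimizers_of_zero_gap _ _ _
  (primal_dom delta f g) (dual_dom f g) (primal_obj C f g) (dual_obj delta C f g)
  (primal_real leb leb A B F G K) (dual_real leb leb A B delta F G K)
  (fun k kd => primal_objE kd.1) (fun h hd => dual_objE hd.1 hd.2)
  (fun k h kd hd => weak_duality mA mB fA fB c0 mF cF FM mG cG GM mK K0 KN
    kd hd.1 hd.2)
  (let: ex_intro k (ex_intro h (And4 kd h1 h2 e)) :=
    zero_gap_pair mA mB fA fB delta0 c0 mF cF FM mG cG GM mK K0 KN in
    ex_intro _ k (ex_intro _ h (And3 kd (conj h1 h2) e))).
split => // k k1 k2 Lk Lk1 Lk2.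
split=> [kmin|[ek e1 e2]].
  have kd : primal_dom delta f g k by case: kmin => -[].
  have := (minP k (k1, k2) kd (conj Lk1 Lk2)).1 kmin.
  move=> /(gap0 _ k (k1, k2) kd Lk1 Lk2)[/best_planE ? e1 e2]; split => //.
    exact/(marginal_densityE _ _ _ cF fF).
  exact/(marginal_densityE _ _ _ cG gG).
have kd : primal_dom delta f g k.
  by split => //; apply: filterS ek => p kp Op; rewrite kp// le_max lexx.
apply/(minP k (k1, k2) kd (conj Lk1 Lk2))/(gap0 _ k (k1, k2) kd Lk1 Lk2).
split; first exact/best_planE.
  exact/(marginal_densityE _ _ _ cF fF).
exact/(marginal_densityE _ _ _ cG gG).
Qed.

End regularized_transport.
Theorem lemma5 (R : realType) (d : nat) (c delta : R)
    (f g : 'rV[R]_d -> R) (C : 'rV[R]_d * 'rV[R]_d -> R) :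
  0 < c -> 0 < delta ->
  (forall p, 0 <= C p) ->
  (* (A1) *) Moo c f -> Moo c g ->
  (* (A2) *)
  convex_set (supp f) -> C11_boundary (supp f) ->
  convex_set (supp g) -> C11_boundary (supp g) ->
  (* (A3) *)
  (delta%:E * maxe (lebesgue_rV d (supp f)) (lebesgue_rV d (supp g)) <= c%:E)%E ->
  (* (A4) *) locally_hoelder C ->
  [/\ exists k, is_minimizer (primal_dom delta f g) (primal_obj C f g) k,
      exists h, is_minimizer (dual_dom f g) (dual_obj delta C f g) h,
      forall (k : 'rV[R]_d * 'rV[R]_d -> R) (k1 k2 : 'rV[R]_d -> R),
        L2 (lebesgue_rV d \x lebesgue_rV d)%E (supp f `*` supp g) k ->
        L2 (lebesgue_rV d) (supp f) k1 ->
        L2 (lebesgue_rV d) (supp g) k2 ->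
        (is_minimizer (primal_dom delta f g) (primal_obj C f g) k /\
         is_minimizer (dual_dom f g) (dual_obj delta C f g) (k1, k2))
        <->
        [/\ \forall p \ae (lebesgue_rV d \x lebesgue_rV d)%E,
              (supp f `*` supp g) p ->
              k p = Num.max delta (k1 p.1 + k2 p.2 - C p),
            \forall x \ae lebesgue_rV d, supp f x ->
              marginal_x (supp g) k x =
                f x * Num.max (delta * vol (supp g) / f x) (1 - k1 x) &
            \forall y \ae lebesgue_rV d, supp g y ->
              marginal_y (supp f) k y =
                g y * Num.max (delta * vol (supp f) / g y) (1 - k2 y)] &
      (primal_value delta C f g + dual_value delta C f g = 0)%E].

Proof.
move=> c0 delta0 C0 Mf Mg _ _ _ _ volc hC.
have [F [MF [mF cF FM fF]]] := density_representative c0 Mf.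
have [G [MG [mG cG GM gG]]] := density_representative c0 Mg.
have [Lf cA _] := Mf; have [Lg cB _] := Mg.
have mf : measurable_fun setT f by move: Lf; rewrite inE => /andP[]; rewrite inE.
have mg : measurable_fun setT g by move: Lg; rewrite inE => /andP[]; rewrite inE.
have [K [N [mK K0 KN CK]]] := cost_representative C0 hC (compact_setX cA cB).
have fmax : (maxe (lebesgue_rV d (supp f)) (lebesgue_rV d (supp g)) < +oo)%E.
  rewrite ltey; apply/eqP => maxy.
  by move: volc; rewrite maxy gt0_muley ?lte_fin// leye_eq.
have [fA fB] : (lebesgue_rV d (supp f) < +oo)%E /\ (lebesgue_rV d (supp g) < +oo)%E.
  by move: fmax; rewrite gt_max => /andP[].
apply: (@regularized_duality _ _ c delta (Num.max MF MG) N f g F G C K) => //.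
- by move=> x; rewrite le_max FM.
- by move=> x; rewrite le_max GM orbT.
Qed.
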